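(* Let $\mathbb{K}$ be an arbitrary field, and let $n$ and $s$ be non-negative integers with $2s<n$. Let $\mathcal{S}$ be an affine subspace of $\mathrm{A}_n(\mathbb{K})$ such that every matrix of $\mathcal{S}$ has rank at most $2s$. Then $$\dim \mathcal{S} \leq \max\bigl(a_{n,2s}^{(1)},a_{n,2s}^{(2)}\bigr).$$ Moreover, if equality holds then at least one of the following holds: (a) $\mathcal{S}$ is congruent to $\mathrm{WA}_{n,2s}(\mathbb{K})$; (b) $\mathcal{S}$ is congruent to $\widetilde{\mathrm{A}_{2s+1}(\mathbb{K})}^{(n)}$; (c) $s=1$, $n=4$, $\#\mathbb{K}=2$ and $\mathcal{S}$ is congruent to $\mathcal{U}(\mathbb{K})$.
   Context: $\mathrm{M}_{n,p}(\mathbb{K})$ is the space of $n\times p$ matrices over $\mathbb{K}$, and $\mathrm{M}_n(\mathbb{K})=\mathrm{M}_{n,n}(\mathbb{K})$. $\mathrm{A}_n(\mathbb{K})$ is the space of $n\times n$ alternating matrices (skew-symmetric with zero diagonal, equivalently $X^TAX=0$ for all $X\in\mathbb{K}^n$). $\#\mathbb{K}$ is the cardinality of $\mathbb{K}$. Affine subspaces are non-empty, and the dimension of an affine subspace is that of its translation vector space. Two subsets $\mathcal{V},\mathcal{W}$ of $\mathrm{M}_n(\mathbb{K})$ are congruent if there is $P\in \mathrm{GL}_n(\mathbb{K})$ with $\mathcal{V}=P\,\mathcal{W}\,P^T$. For $r=2s<n$: $a_{n,r}^{(1)}:=\binom{r+1}{2}$ and $a_{n,r}^{(2)}:=\binom{s}{2}+s(n-s)$.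 For $k\le n$ and a subset $\mathcal{V}$ of $\mathrm{M}_k(\mathbb{K})$, $$\widetilde{\mathcal{V}}^{(n)}:=\Bigl\{\begin{bmatrix} S & 0_{k\times(n-k)}\\ 0_{(n-k)\times k} & 0_{(n-k)\times(n-k)}\end{bmatrix} \mid S\in\mathcal{V}\Bigr\}\subset \mathrm{M}_n(\mathbb{K}).$$ For $r=2s$, $$\mathrm{WA}_{n,r}(\mathbb{K}):=\Bigl\{\begin{bmatrix} A & B\\ -B^T & 0_{(n-s)\times(n-s)}\end{bmatrix}\mid A\in \mathrm{A}_s(\mathbb{K}),\ B\in \mathrm{M}_{s,n-s}(\mathbb{K})\Bigr\}.$$ If $\#\mathbb{K}=2$, $$\mathcal{U}(\mathbb{K}):=\left\{\begin{bmatrix} 0&a&b&c+1\\ a&0&c&0\\ b&c&0&0\\ c+1&0&0&0\end{bmatrix}\mid (a,b,c)\in\mathbb{K}^3\right\}\subset \mathrm{A}_4(\mathbb{K}).$$ *)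

(* Defs.v *)
From HB Require Import structures.
From mathcomp Require Import all_boot all_order all_algebra.

Set Implicit Arguments.
Unset Strict Implicit.
Unset Printing Implicit Defensive.

Import GRing.Theory.
Local Open Scope ring_scope.

(* Subsets of 'M[K]_n are predicates 'M[K]_n -> Prop. *)

(* The diagonal condition is independent of skew-symmetry only in
   characteristic 2. *)
Definition alternating (K : fieldType) (n : nat) (A : 'M[K]_n) : Prop :=
  A^T = - A /\ forall i : 'I_n, A i i = 0.

(* S is an affine subspace with translation vector space V. Such an S contains
   A0, hence is non-empty, and determines V; its dimension is \dim V. *)
Definition affine_subspace (K : fieldType) (n : nat)
    (S : 'M[K]_n -> Prop) (V : {vspace 'M[K]_n}) : Prop :=
  exists A0 : 'M[K]_n, forall A : 'M[K]_n, S A <-> A - A0 \in V.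

Definition congruent (K : fieldType) (n : nat)
    (V W : 'M[K]_n -> Prop) : Prop :=
  exists2 P : 'M[K]_n, P \in unitmx &
    forall A : 'M[K]_n, V A <-> exists2 B : 'M[K]_n, W B & A = P *m B *m P^T.

Definition a1 (n r : nat) : nat := 'C(r.+1, 2).

Definition a2 (n r : nat) : nat :=
  let s := r./2 in ('C(s, 2) + s * (n - s))%N.

(* Identifies 'M_m and 'M_n along m = n, for sets of matrices. *)
Definition cast_set (K : fieldType) (m n : nat) (e : m = n)
    (V : 'M[K]_m -> Prop) : 'M[K]_n -> Prop :=
  fun M => exists2 N : 'M[K]_m, V N & M = castmx (e, e) N.

Definition tilde (K : fieldType) (n k : nat) (hkn : (k <= n)%N)
    (V : 'M[K]_k -> Prop) : 'M[K]_n -> Prop :=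
  cast_set (subnKC hkn)
    (fun M : 'M[K]_(k + (n - k)) =>
       exists2 S : 'M[K]_k, V S & M = block_mx S 0 0 0).

Lemma leq_half_rank (n s : nat) : (2 * s < n)%N -> (s <= n)%N.
Proof. by move/ltnW; apply: leq_trans; rewrite leq_pmull. Qed.

(* WA_{n,r} for r = 2s. *)
Definition WA (K : fieldType) (n s : nat) (hs : (2 * s < n)%N) :
    'M[K]_n -> Prop :=
  cast_set (subnKC (leq_half_rank hs))
    (fun M : 'M[K]_(s + (n - s)) =>
       exists (A : 'M[K]_s) (B : 'M[K]_(s, n - s)),
         alternating A /\ M = block_mx A B (- B^T) 0).

Definition has_card (T : eqType) (m : nat) : Prop :=
  exists l : seq T, [/\ uniq l, size l = m & forall x : T, x \in l].

Definition Umx (K : fieldType) (a b c : K) : 'M[K]_4 :=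
  \matrix_(i < 4, j < 4)
    nth 0 (nth [::] [:: [:: 0;     a; b; c + 1];
                        [:: a;     0; c; 0];
                        [:: b;     c; 0; 0];
                        [:: c + 1; 0; 0; 0]] i) j.

Definition U (K : fieldType) : 'M[K]_4 -> Prop :=
  fun M => exists a b c : K, M = Umx a b c.

(* Main.v *)
Require Import Defs.
From HB Require Import structures.
From mathcomp Require Import all_boot all_order all_fingroup all_algebra.
From mathcomp Require Import zify ring.
From Stdlib Require Import Classical.

(** The theorem is a linear version of the Erdos-Gallai theorem on graphs with
    [n] vertices and no [s + 1] disjoint edges, whose two extremal
    configurations (a clique on [2 * s + 1] vertices, and all the edges that
    meet a given set of [s] vertices) account for the two terms of the maximum.

    Let [A0 + V] be the affine space. The edges are the rank 2 matrices
    [wedge x y = x^T *m y - y^T *m x] in [V], and the degree of a vector [x] is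
    [\dim (nbr V x) - 1] where [nbr V x] is the space of all [y] with
    [wedge x y] in [V]. The substitute for deleting a vertex [x] is to pass to
    the quotient by [x], that is to restrict alternating forms to the
    annihilator of [x]: [dim_quotient] says that the dimension drops by the
    degree of [x]. The link with ranks is [extraction]: in the quotient by [x]
    and [y], where [wedge x y] is in [V], all ranks are at most [2 * s - 2].
    It only uses that two scalars are available, [A] and [A + wedge x y], so it
    holds over every field and for affine spaces. Consequently a matching, a
    set of wedges in [V] whose endpoints are all independent, has at most [s]
    elements ([matching_size]).

    A maximal matching, with span [Z], controls the degrees outside [Z]. If [z]
    and [z'] are independent modulo [Z], the exchange argument for augmenting
    paths shows that their neighbourhoods meet [Z] in subspaces that are
    orthogonal for a symplectic form on [Z] ([exchange]), so the sum of their
    degrees is at most [2 * s]. Hence when [n >= 2 * s + 2] there is a vector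
    of degree at most [s] ([low_degree]), and if all degrees are at least [s],
    the traces on [Z] are Lagrangian and all equal to one space [T] of dimension
    [s], joined to everything ([saturated]).

    The bound follows by induction ([dim_bound]): a vector of degree 0 is
    removed at no cost, and if there is none, a vector of degree at most [s] is
    removed together with one of its neighbours, which lowers [s]. In the case
    of equality ([dim_extremal]), either all degrees are at least [s], and then
    the space consists of all matrices in the span of the wedges with a vector
    of [T], which is case (a); or vectors of degree 0 can be removed until
    dimension [2 * s + 1], and the affine space is then the graph of an affine
    map defined on all alternating matrices [A] of size [2 * s + 1]. In this
    last case the rank condition says that this map sends [A] into the image of
    [A] when [A] has rank [2 * s]. If nondegenerate matrices affinely span the
    alternating ones of size [2 * s], the map must be [A |-> Z^T *m A *m Z]
    ([full_restriction]), which is case (b). They fail to do so only for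
    [s = 1] over the field with two elements, where an explicit computation
    adds case (c). *)

Set Implicit Arguments.
Unset Strict Implicit.
Unset Printing Implicit Defensive.

Import GRing.Theory.
Local Open Scope ring_scope.

(** * Alternating matrices and wedges *)

(** The bivector of [x] and [y]. *)
Definition wedge (K : fieldType) n (x y : 'rV[K]_n) : 'M[K]_n := x^T *m y - y^T *m x.

Section Alternating.
Variable K : fieldType.
Implicit Types n m : nat.

Lemma alternatingP n (A : 'M[K]_n) :
  alternating A <-> exists B : 'M[K]_n, A = B - B^T.
Proof.
split=> [[At A0]|[B ->]]; last first.
  split; first by rewrite linearB /= trmxK opprB.
  by move=> i; rewrite !mxE subrr.
exists (\matrix_(i, j) if (i < j)%N then A i j else 0).
apply/matrixP=> i j; rewrite !mxE.
case: ltngtP => [ij|ji|/val_inj ij]; rewrite ?subr0 ?sub0r //.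
  by have := congr1 (fun M : 'M_n => M i j) At; rewrite !mxE => ->; rewrite opprK.
by rewrite ij A0.
Qed.

Lemma alternating_conj n m (Q : 'M[K]_(n, m)) (A : 'M[K]_n) :
  alternating A -> alternating (Q^T *m A *m Q).
Proof.
case/alternatingP=> B ->; apply/alternatingP; exists (Q^T *m B *m Q).
by rewrite mulmxBr mulmxBl !trmx_mul trmxK mulmxA.
Qed.

Lemma alternatingD n (A B : 'M[K]_n) :
  alternating A -> alternating B -> alternating (A + B).
Proof.
move=> [At A0] [Bt B0]; split=> [|i]; first by rewrite linearD /= At Bt opprD.
by rewrite !mxE A0 B0 addr0.
Qed.

Lemma alternatingZ n a (A : 'M[K]_n) : alternating A -> alternating (a *: A).
Proof.
move=> [At A0]; split=> [|i]; first by rewrite linearZ /= At scalerN.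
by rewrite !mxE A0 mulr0.
Qed.

Lemma alternatingN n (A : 'M[K]_n) : alternating A -> alternating (- A).
Proof. by rewrite -scaleN1r; apply: alternatingZ. Qed.

Lemma alternatingB n (A B : 'M[K]_n) :
  alternating A -> alternating B -> alternating (A - B).
Proof. by move=> hA hB; apply: alternatingD => //; apply: alternatingN. Qed.

Lemma alternating_entry n (A : 'M[K]_n) i j : alternating A -> A j i = - A i j.
Proof.
by case=> At _; have := congr1 (fun M : 'M_n => M i j) At; rewrite !mxE.
Qed.

Lemma alternating_wedge n (x y : 'rV[K]_n) : alternating (wedge x y).
Proof.
by apply/alternatingP; exists (x^T *m y); rewrite trmx_mul trmxK.
Qed.

Lemma wedgeE n (x y : 'rV[K]_n) i j :
  wedge x y i j = x 0 i * y 0 j - y 0 i * x 0 j.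
Proof. by rewrite !mxE !big_ord1 !mxE. Qed.

Lemma wedge_is_linear n (x : 'rV[K]_n) : linear (wedge x).
Proof. by move=> a u v; apply/matrixP=> i j; rewrite !(wedgeE, mxE); ring. Qed.

HB.instance Definition _ n (x : 'rV[K]_n) :=
  GRing.isLinear.Build K 'rV[K]_n 'M[K]_n _ (wedge x) (@wedge_is_linear n x).

Lemma wedgeDr n (x u v : 'rV[K]_n) : wedge x (u + v) = wedge x u + wedge x v.
Proof. exact: linearD. Qed.

Lemma wedgeZr n (x u : 'rV[K]_n) a : wedge x (a *: u) = a *: wedge x u.
Proof. exact: linearZ. Qed.

Lemma wedgeC n (x y : 'rV[K]_n) : wedge y x = - wedge x y.
Proof. by rewrite /wedge opprB. Qed.

Lemma wedgexx n (x : 'rV[K]_n) : wedge x x = 0.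
Proof. by rewrite /wedge subrr. Qed.

Lemma wedge_conj n m (Q : 'M[K]_(n, m)) (x y : 'rV[K]_n) :
  Q^T *m wedge x y *m Q = wedge (x *m Q) (y *m Q).
Proof. by rewrite /wedge mulmxBr mulmxBl !trmx_mul !mulmxA. Qed.

Lemma wedge_eq0 n (x y : 'rV[K]_n) :
  wedge x y = 0 -> x != 0 -> exists a, y = a *: x.
Proof.
move=> w0 /rV0Pn[i xi0]; exists (y 0 i / x 0 i); apply/rowP=> j; rewrite !mxE.
have := wedgeE x y i j; rewrite w0 mxE => /eqP; rewrite eq_sym subr_eq0 => /eqP e.
by apply: (mulfI xi0); rewrite e; field.
Qed.

(** Wedderburn's rank reduction: if [c = A i j] is nonzero, subtracting
    [c^-1 *: wedge (row i A) (row j A)] from [A] kills the rows and columns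
    [i] and [j], stays alternating and lowers the rank by exactly 2. This
    replaces the usual argument with Pfaffians, in every characteristic. *)
Lemma rank_alternating_even n (A : 'M[K]_n) : alternating A -> ~~ odd (\rank A).
Proof.
have [r] := ubnP (\rank A); elim: r => // r IH in A *; rewrite ltnS => rA altA.
have [->|] := eqVneq A 0; first by rewrite mxrank0.
case/matrix0Pn=> i [j Aij0].
have altii k : A k k = 0 by case: altA.
have Aji := alternating_entry i j altA.
pose a := row i A; pose b := row j A; pose c := A i j.
pose A' := A - c^-1 *: wedge a b.
have altA' : alternating A'.
  by apply: alternatingB => //; apply/alternatingZ/alternating_wedge.
have rowi : row i A' = 0.
  apply/rowP=> k; rewrite /A' /a /b 2!mxE [X in _ + X]mxE [X in _ - X]mxE wedgeE !mxE.
  by rewrite altii Aji /c; field.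
have rowj : row j A' = 0.
  apply/rowP=> k; rewrite /A' /a /b 2!mxE [X in _ + X]mxE [X in _ - X]mxE wedgeE !mxE.
  by rewrite altii /c; field.
have A'i k : A' k i = 0.
  rewrite (alternating_entry i k altA'); move/rowP/(_ k): rowi; rewrite !mxE => ->.
  by rewrite oppr0.
have A'j k : A' k j = 0.
  rewrite (alternating_entry j k altA'); move/rowP/(_ k): rowj; rewrite !mxE => ->.
  by rewrite oppr0.
pose X := col_mx a b.
have wX : (wedge a b <= X)%MS.
  by rewrite /wedge addmx_sub ?eqmx_opp // mulmx_sub // -addsmxE ?addsmxSl ?addsmxSr.
have XA : (X <= A)%MS by rewrite -addsmxE addsmx_sub !row_sub.
have AE : A = A' + c^-1 *: wedge a b by rewrite subrK.
(* Rows of A' vanish at i and j, while a and b restrict there to c times an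
   invertible 2 x 2 matrix. *)
have cap0 : (A' :&: X = 0)%MS.
  apply/eqP; rewrite -submx0; apply/row_subP => k.
  set v := row k _.
  have vA : (v <= A' :&: X)%MS by rewrite row_sub.
  move: vA; rewrite sub_capmx => /andP[/submxP[D Dv] /submxP[E Ev]].
  have vi : v 0 i = 0 by rewrite Dv mxE big1 // => l _; rewrite A'i mulr0.
  have vj : v 0 j = 0 by rewrite Dv mxE big1 // => l _; rewrite A'j mulr0.
  have Ev' : v = lsubmx (E : 'M_(_, 1 + 1)) *m a + rsubmx (E : 'M_(_, 1 + 1)) *m b.
    by rewrite -mul_row_col hsubmxK.
  have ei : v 0 i = lsubmx (E : 'M_(_, 1 + 1)) 0 0 * a 0 i + rsubmx (E : 'M_(_, 1 + 1)) 0 0 * b 0 i.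
    by rewrite {1}Ev' mxE [X in X + _]mxE [X in _ + X]mxE !big_ord1.
  have ej : v 0 j = lsubmx (E : 'M_(_, 1 + 1)) 0 0 * a 0 j + rsubmx (E : 'M_(_, 1 + 1)) 0 0 * b 0 j.
    by rewrite {1}Ev' mxE [X in X + _]mxE [X in _ + X]mxE !big_ord1.
  move: ei ej; rewrite vi vj ![a 0 _]mxE ![b 0 _]mxE !altii Aji !mulr0 add0r addr0.
  move=> /eqP; rewrite eq_sym mulrN oppr_eq0 mulf_eq0 (negPf Aij0) orbF => /eqP r0.
  move=> /eqP; rewrite eq_sym mulf_eq0 (negPf Aij0) orbF => /eqP l0.
  rewrite Ev' [lsubmx _]mx11_scalar [rsubmx _]mx11_scalar l0 r0.
  by rewrite !raddf0 !mul0mx addr0 sub0mx.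
have rX : \rank X = 2%N.
  apply/eqP; apply/row_freeP.
  exists (row_mx (c^-1 *: (delta_mx j 0 : 'cV_n)) (- c^-1 *: (delta_mx i 0 : 'cV_n))).
  rewrite (mul_col_row a b) -!scalemxAr -!colE.
  rewrite [1%:M](_ : _ = block_mx (1%:M : 'M_1) 0 0 (1%:M : 'M_1)); last by rewrite -scalar_mx_block.
  by congr block_mx; apply/matrixP=> p q; rewrite !ord1 !mxE ?eqxx ?altii ?Aji ?mulr0 //= ?/c ?mulrNN ?mulVf.
have rsum := mxrank_disjoint_sum cap0.
have A'A : (A' <= A)%MS.
  rewrite /A' addmx_sub // eqmx_opp scalemx_sub //.
  exact: submx_trans wX XA.
have rk : \rank A = (\rank A' + 2)%N.
  apply/eqP; rewrite -rX -rsum eqn_leq !mxrankS //; first by rewrite addsmx_sub A'A XA.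
  by rewrite {1}AE addmx_sub_adds // scalemx_sub.
rewrite rk oddD addbF; apply: IH => //.
by apply: leq_trans rA; rewrite rk addn2.
Qed.

(** When restricting a skew-symmetric [M] along [Q] does not lower its rank,
    the row space of [Q^T *m M] is already that of [M], hence [M] is recovered
    from its restriction by a congruence. *)
Lemma conj_rank_factor n m (Q : 'M[K]_(n, m)) (M : 'M[K]_n) :
  M^T = - M -> (\rank M <= \rank (Q^T *m M *m Q))%N ->
  exists Y : 'M[K]_(m, n),
    [/\ M = Y^T *m (Q^T *m M *m Q) *m Y, Q^T *m M = Q^T *m M *m Q *m Y
      & M *m Q = Y^T *m (Q^T *m M *m Q)].
Proof.
move=> Mt rM.
have sub : (Q^T *m M <= M)%MS by apply: submxMl.
have /submxP[Y' eY] : (M <= Q^T *m M)%MS.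
  rewrite -(geq_leqif (mxrank_leqif_sup sub)).
  exact: leq_trans rM (mxrankM_maxl _ _).
have eY2 : M = M *m Q *m Y'^T.
  apply: oppr_inj; rewrite -Mt [in LHS]eY !trmx_mul trmxK Mt.
  by rewrite !mulNmx.
exists Y'^T; rewrite trmxK; split.
- by rewrite {1}eY {1}eY2 !mulmxA.
- by rewrite {1}eY2 !mulmxA.
- by rewrite {1}eY !mulmxA.
Qed.

(** If two skew-symmetric matrices that agree after multiplication by [Q^T]
    both have rank at most [r], and their common restriction had rank [r], then
    both would be determined by that restriction, hence be equal. *)
Lemma extraction n m (Q : 'M[K]_(n, m)) (M M' : 'M[K]_n) r :
  M^T = - M -> M'^T = - M' -> (\rank M <= r)%N -> (\rank M' <= r)%N ->
  Q^T *m M = Q^T *m M' -> M != M' -> (\rank (Q^T *m M *m Q) < r)%N.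
Proof.
move=> Mt Mt' rM rM' eQ; apply: contraNT; rewrite -leqNgt => rP.
have [Y [MY QY YQ]] := conj_rank_factor Mt (leq_trans rM rP).
have [|Y' [MY' QY' YQ']] := @conj_rank_factor _ _ Q _ Mt'.
  by rewrite -eQ (leq_trans rM' rP).
have eQ' : M *m Q = M' *m Q.
  apply: trmx_inj; rewrite !trmx_mul Mt Mt' !mulmxN.
  by rewrite eQ.
apply/eqP; rewrite MY MY' -YQ -YQ' eQ' YQ' -!mulmxA; congr (_ *m _).
by rewrite !mulmxA -QY' -eQ -QY.
Qed.

End Alternating.

(** * Restriction along a matrix, and quotients by a vector *)

Section Quotient.
Variable K : fieldType.
Implicit Types n m k s : nat.

(** Seeing alternating matrices as alternating forms on the dual space, this
    is the pullback along [Q]; seeing them as bivectors, it is the image under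
    [u |-> u *m Q]. *)
Definition restr n m (Q : 'M[K]_(n, m)) : 'Hom('M[K]_n, 'M[K]_m) :=
  linfun (mulmxr Q \o mulmx Q^T).

Lemma restrE n m (Q : 'M[K]_(n, m)) N : restr Q N = Q^T *m N *m Q.
Proof. by rewrite lfunE. Qed.

Lemma restrD n m (Q : 'M[K]_(n, m)) (A B : 'M[K]_n) :
  restr Q (A + B) = restr Q A + restr Q B.
Proof. exact: linearD. Qed.

Lemma restrZ n m (Q : 'M[K]_(n, m)) a (A : 'M[K]_n) :
  restr Q (a *: A) = a *: restr Q A.
Proof. exact: linearZ. Qed.

Lemma restr_comp n m k (Q : 'M[K]_(n, m)) (Q' : 'M[K]_(m, k)) N :
  restr Q' (restr Q N) = restr (Q *m Q') N.
Proof. by rewrite !restrE trmx_mul !mulmxA. Qed.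

Lemma restr_wedge n m (Q : 'M[K]_(n, m)) x y :
  restr Q (wedge x y) = wedge (x *m Q) (y *m Q).
Proof. by rewrite restrE wedge_conj. Qed.

Definition altv n : {vspace 'M[K]_n} := limg (\1 - linfun trmx)%VF.

Lemma memv_alt n (A : 'M[K]_n) : reflect (alternating A) (A \in altv n).
Proof.
apply: (iffP memv_imgP) => [[B _ ->]|/alternatingP[B ->]].
  by apply/alternatingP; exists B; rewrite !lfun_simp /= ?lfunE.
by exists B; rewrite ?memvf // !lfun_simp /= ?lfunE.
Qed.

Lemma restr_alt n m (Q : 'M[K]_(n, m)) (V : {vspace 'M[K]_n}) :
  (V <= altv n)%VS -> (restr Q @: V <= altv m)%VS.
Proof.
move=> /subvP sV; apply/subvP => _ /memv_imgP[N /sV/memv_alt altN ->].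
by apply/memv_alt; rewrite restrE; apply: alternating_conj.
Qed.

(** Its dimension minus 1 plays the part of the degree of the vertex [x] in a
    graph, since [x] itself always belongs to it. *)
Definition nbr n (V : {vspace 'M[K]_n}) (x : 'rV[K]_n) : {vspace 'rV[K]_n} :=
  (linfun (wedge x) @^-1: V)%VS.

Lemma mem_nbr n (V : {vspace 'M[K]_n}) x u : (u \in nbr V x) = (wedge x u \in V).
Proof. by rewrite -memv_preim lfunE. Qed.

Lemma nbrC n (V : {vspace 'M[K]_n}) x y : (x \in nbr V y) = (y \in nbr V x).
Proof. by rewrite !mem_nbr wedgeC memvN. Qed.

Lemma nbrxx n (V : {vspace 'M[K]_n}) x : x \in nbr V x.
Proof. by rewrite mem_nbr wedgexx mem0v. Qed.

(** The completion is read off the Gaussian elimination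
    [X = L *m pid_mx k *m U]. *)
Lemma completion k m (X : 'M[K]_(k, k + m)) : row_free X ->
  exists R : 'M[K]_(m, k + m), col_mx X R \in unitmx.
Proof.
move=> /eqP rX; have eX := mulmx_ebase X; rewrite rX in eX.
exists (row_mx 0 1%:M *m row_ebase X).
have -> : col_mx X (row_mx 0 1%:M *m row_ebase X) =
    block_mx (col_ebase X) 0 0 1%:M *m row_ebase X.
  rewrite -{1}eX [block_mx _ _ _ _]block_mxEv mul_col_mx; congr (col_mx (_ *m _) _).
  by rewrite pid_mx_row mul_mx_row mulmx1 mulmx0.
by rewrite unitmx_mul row_ebase_unit andbT unitmxE det_lblock det1 mulr1 -unitmxE col_ebase_unit.
Qed.

Lemma quotient_maps k m (X : 'M[K]_(k, k + m)) : row_free X ->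
  exists (Y : 'M[K]_(k + m, k)) (Q : 'M[K]_(k + m, m)) (R : 'M[K]_(m, k + m)),
    [/\ X *m Y = 1%:M, X *m Q = 0, R *m Q = 1%:M, col_mx X R \in unitmx
      & Y *m X + Q *m R = 1%:M].
Proof.
move=> /completion[R uP]; set P := col_mx X R in uP *.
exists (lsubmx (invmx P)), (rsubmx (invmx P)), R.
have := mulmxV uP; rewrite -{1}(hsubmxK (invmx P)) {1}/P mul_col_row.
move/esym; rewrite {1}scalar_mx_block => /eq_block_mx[<- <- _ <-]; split=> //.
by rewrite -mul_row_col hsubmxK mulVmx.
Qed.

Lemma row_free_rV n (z : 'rV[K]_n) : row_free z = (z != 0).
Proof. by rewrite -row_leq_rank lt0n mxrank_eq0. Qed.

(** [u |-> u *m Q] is a quotient map with kernel the line of [z]; the last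
    identity splits every vector along [z] and a complement. *)
Definition proj_along n m (z : 'rV[K]_n) (Q : 'M[K]_(n, m)) :=
  z *m Q = 0 /\ exists (Y : 'cV[K]_n) (R : 'M[K]_(m, n)),
    R *m Q = 1%:M /\ Y *m z + Q *m R = 1%:M.

Lemma proj_along_exists n (z : 'rV[K]_n.+1) :
  z != 0 -> exists Q : 'M[K]_(n.+1, n), proj_along z Q.
Proof.
rewrite -row_free_rV => /(@quotient_maps 1 n)[Y [Q [R [_ zQ RQ _ YQ]]]].
by exists Q; split=> //; exists Y, R.
Qed.

Lemma proj_along_ker n m (z u : 'rV[K]_n) (Q : 'M[K]_(n, m)) :
  proj_along z Q -> u *m Q = 0 -> u \in <[z]>%VS.
Proof.
move=> [_ [Y [R [_ YQ]]]] uQ; apply/vlineP; exists ((u *m Y) 0 0).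
rewrite -mul_scalar_mx -mx11_scalar -[LHS]mulmx1 -YQ mulmxDr !mulmxA uQ.
by rewrite mul0mx addr0.
Qed.

Lemma restr_ker n m (z : 'rV[K]_n) (Q : 'M[K]_(n, m)) N :
  proj_along z Q -> alternating N -> restr Q N = 0 -> exists u, N = wedge z u.
Proof.
move=> [_ [Y [R [_ YQ]]]] altN; rewrite restrE => N0.
exists (Y^T *m N *m Q *m R).
have c0 : Y^T *m N *m Y = 0.
  have [_ d0] := alternating_conj Y altN.
  by rewrite [LHS]mx11_scalar d0 raddf0.
have Nt : N^T = - N by case: altN.
have tYQ : z^T *m Y^T + R^T *m Q^T = 1%:M.
  by rewrite -!trmx_mul -linearD /= YQ trmx1.
have eN : N = (z^T *m Y^T + R^T *m Q^T) *m N *m (Y *m z + Q *m R).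
  by rewrite tYQ YQ mul1mx mulmx1.
rewrite [LHS]eN.
rewrite !mulmxDl !mulmxDr !mulmxA.
have -> : z^T *m Y^T *m N *m Y = 0.
  by rewrite -!mulmxA [Y^T *m (N *m Y)]mulmxA c0 mulmx0.
have -> : R^T *m Q^T *m N *m Q = 0.
  by rewrite -!mulmxA [Q^T *m (N *m Q)]mulmxA N0 mulmx0.
rewrite !mul0mx add0r addr0 /wedge !trmx_mul trmxK Nt.
by rewrite !mulmxA mulmxN !mulNmx opprK addrC.
Qed.

(** Rank-nullity for [restr Q]: its kernel on [V] is [wedge z @: nbr V z], on
    which only the line of [z] is lost. *)
Lemma dim_quotient n m (z : 'rV[K]_n) (Q : 'M[K]_(n, m)) (V : {vspace 'M[K]_n}) :
  z != 0 -> proj_along z Q -> (V <= altv n)%VS ->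
  (\dim V).+1 = (\dim (nbr V z) + \dim (restr Q @: V))%N.
Proof.
move=> z0 pQ /subvP altV.
rewrite -(limg_ker_dim (restr Q) V).
have -> : (V :&: lker (restr Q) = linfun (wedge z) @: nbr V z)%VS.
  apply/vspaceP => N; rewrite memv_cap memv_ker; apply/andP/memv_imgP.
    case=> NV /eqP/(restr_ker pQ (memv_alt _ (altV _ NV)))[u Nu].
    by exists u; rewrite ?mem_nbr ?lfunE // -Nu.
  case=> u; rewrite mem_nbr lfunE => uV ->; split=> //.
  by rewrite restr_wedge (proj1 pQ) wedgeC linear0 oppr0.
rewrite -(limg_ker_dim (linfun (wedge z)) (nbr V z)).
suff -> : (nbr V z :&: lker (linfun (wedge z)) = <[z]>)%VS.
  by rewrite dim_vline z0 add1n addSn.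
apply/vspaceP => u; rewrite memv_cap memv_ker mem_nbr lfunE.
apply/andP/vlineP => [[_ /eqP/wedge_eq0]|[a ->]]; first exact.
by rewrite linearZ /= wedgexx scaler0 mem0v; split=> //; rewrite linearZ /= wedgexx scaler0.
Qed.

Lemma dim_nbr n (V : {vspace 'M[K]_n}) z : (\dim (nbr V z) <= n)%N.
Proof. by rewrite (leq_trans (dimvS (subvf _))) // dimvf dim_matrix mul1r. Qed.

(** Each quotient by a vector of a space of dimension [n.+1] costs at most [n]
    dimensions. *)
Lemma dim_alt n (V : {vspace 'M[K]_n}) : (V <= altv n)%VS -> (\dim V <= 'C(n, 2))%N.
Proof.
elim: n V => [|n IH] V altV.
  by rewrite (leq_trans (dimvS (subvf _))) // dimvf dim_matrix.
have e0 : delta_mx 0 0 != 0 :> 'rV[K]_n.+1.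
  by apply/rV0Pn; exists 0; rewrite mxE !eqxx oner_eq0.
have [Q pQ] := proj_along_exists e0.
have := dim_quotient e0 pQ altV; have := IH _ (restr_alt Q altV).
have := dim_nbr V (delta_mx 0 0); rewrite binS bin1; move: (\dim V) (\dim _) (\dim _); lia.
Qed.

(** * Affine spaces of bounded rank *)

Definition bounded n (A0 : 'M[K]_n) (V : {vspace 'M[K]_n}) s :=
  [/\ alternating A0, (V <= altv n)%VS
    & forall N, N \in V -> (\rank (A0 + N)%R <= s.*2)%N].

Lemma bounded_alt n A0 V s (N : 'M[K]_n) :
  bounded A0 V s -> N \in V -> alternating (A0 + N).
Proof.
by case=> altA0 /subvP altV _ /altV/memv_alt altN; apply: alternatingD.
Qed.

Lemma bounded_restr n m (Q : 'M[K]_(n, m)) A0 V s :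
  bounded A0 V s -> bounded (restr Q A0) (restr Q @: V)%VS s.
Proof.
case=> altA0 altV rV; split.
- by rewrite restrE; apply: alternating_conj.
- exact: restr_alt.
move=> _ /memv_imgP[N /rV rN ->]; rewrite -restrD restrE.
apply: leq_trans rN; apply: leq_trans (mxrankM_maxl _ _) _.
exact: mxrankM_maxr.
Qed.

Lemma rank_even_lt n (A : 'M[K]_n) s :
  alternating A -> (\rank A < s.*2)%N -> (\rank A + 2 <= s.*2)%N.
Proof.
move/rank_alternating_even => evA ltA.
have := odd_double_half (\rank A); rewrite (negPf evA); lia.
Qed.

(** Every wedge in [V] that [Q] kills costs 2 in the rank bound. By induction,
    it suffices to deal with the first pair [x], [y], after projecting along the
    other pairs with [Q']: the matrices [M1] and [M2 = M1 + wedge x y] have the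
    same restriction to [Q] and the same bound on the rank, so that
    [extraction] makes this bound strict, and the parity of the rank turns 1
    into 2. *)
Lemma matching_rank n t (X Y : 'M[K]_(t, n)) m (Q : 'M[K]_(n, m)) A0 V s N :
  bounded A0 V s -> (forall i, wedge (row i X) (row i Y) \in V) ->
  row_free (col_mx X Y) -> X *m Q = 0 -> Y *m Q = 0 -> N \in V ->
  (\rank (restr Q (A0 + N)%R) + t.*2 <= s.*2)%N.
Proof.
move=> bS; elim: t X Y m Q N => [|t IH]; last rewrite -[t.+1]/(1 + t)%N; move=> X Y m Q N.
  move=> _ _ _ _ NV; have [_ _ rS] := bounded_restr Q bS.
  by rewrite addn0 linearD /= rS // memv_img.
have splitE (M : 'M[K]_(1 + t, n)) :
    exists (x : 'rV_n) (M' : 'M_(t, n)), M = col_mx x M'.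
  by exists (usubmx M), (dsubmx M); rewrite vsubmxK.
have [x [X' ->]] := splitE X; have [y [Y' ->]] := splitE Y => {X Y splitE}.
move=> XYV free_XY XQ YQ NV.
move: XQ YQ; rewrite !mul_col_mx => /eqP; rewrite col_mx_eq0 => /andP[/eqP xQ /eqP XQ].
move=> /eqP; rewrite col_mx_eq0 => /andP[/eqP yQ /eqP YQ].
(* Q' is a projection whose kernel is the row space of Z. *)
pose Z := col_mx X' Y'; pose Q' : 'M_n := 1%:M - pinvmx Z *m Z.
have ZQ : Z *m Q = 0 by rewrite mul_col_mx XQ YQ col_mx0.
have QQ : Q' *m Q = Q by rewrite mulmxBl mul1mx -mulmxA ZQ mulmx0 subr0.
have ZQ' : Z *m Q' = 0 by rewrite mulmxBr mulmx1 mulmxA mulmxKpV ?subrr.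
have kerQ' (u : 'rV_n) : u *m Q' = 0 -> (u <= Z)%MS.
  rewrite mulmxBr mulmx1 mulmxA => /eqP; rewrite subr_eq0 => /eqP ->.
  exact: submxMl.
have free_Z : row_free (col_mx X' Y') /\ forall a b, ((a *: x + b *: y)%R <= Z)%MS -> a = 0 /\ b = 0.
  have inj (c d : 'rV_(1 + t)) : c *m col_mx x X' + d *m col_mx y Y' = 0 -> c = 0 /\ d = 0.
    rewrite -mul_row_col => /eqP; rewrite (mulmx_free_eq0 _ free_XY).
    by rewrite row_mx_eq0 => /andP[/eqP-> /eqP->].
  split=> [|a b /submxP[D eD]].
    rewrite -kermx_eq0; apply/eqP/row_matrixP => i; rewrite row0.
    set v := row i _; have : v *m Z = 0 by rewrite -row_mul mulmx_ker row0.
    rewrite -[v]hsubmxK mul_row_col => e.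
    have [] := inj (row_mx 0 (lsubmx v)) (row_mx 0 (rsubmx v)).
      by rewrite !mul_row_col !mul0mx !add0r.
    move=> /eqP; rewrite row_mx_eq0 => /andP[_ /eqP ->].
    move=> /eqP; rewrite row_mx_eq0 => /andP[_ /eqP ->].
    by rewrite row_mx0.
  have [] := inj (row_mx a%:M (- lsubmx D)) (row_mx b%:M (- rsubmx D)).
    rewrite !mul_row_col !mul_scalar_mx addrACA eD -{1}[D]hsubmxK mul_row_col.
    by rewrite !mulNmx -opprD subrr.
  move=> /eqP; rewrite row_mx_eq0 => /andP[/eqP a0 _].
  move=> /eqP; rewrite row_mx_eq0 => /andP[/eqP b0 _].
  move/matrixP: a0 => /(_ 0 0); move/matrixP: b0 => /(_ 0 0).
  by rewrite !mxE eqxx !mulr1n => -> ->.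
have [{}free_Z indep] := free_Z.
have XYV' i : wedge (row i X') (row i Y') \in V.
  by have := XYV (rshift 1 i); rewrite !rowKd.
have xyV : wedge x y \in V.
  by have := XYV (lshift t 0); rewrite !rowKu !row_id.
have IH' M : M \in V -> (\rank (restr Q' (A0 + M)%R) + t.*2 <= s.*2)%N.
  apply: (IH X' Y') => //; move: ZQ'; rewrite mul_col_mx => /eqP.
    by rewrite col_mx_eq0 => /andP[/eqP].
  by rewrite col_mx_eq0 => /andP[_ /eqP].
pose M1 := restr Q' (A0 + N); pose M2 := restr Q' (A0 + (N + wedge x y)).
have r1 : (\rank M1 <= (s - t).*2)%N by have := IH' _ NV; rewrite -/M1; move: (\rank M1) => r; lia.
have r2 : (\rank M2 <= (s - t).*2)%N.
  have NV2 : N + wedge x y \in V by rewrite memvD.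
  by have := IH' _ NV2; rewrite -/M2; move: (\rank M2) => r; lia.
have alt1 : alternating M1.
  by rewrite /M1 restrE; apply/alternating_conj/(bounded_alt bS).
have alt2 : alternating M2.
  by rewrite /M2 restrE; apply/alternating_conj/(bounded_alt bS); rewrite memvD.
have M21 : M2 = M1 + wedge (x *m Q') (y *m Q').
  by rewrite /M2 addrA restrD restr_wedge.
have neq : M1 != M2.
  rewrite M21 eq_sym -subr_eq0 addrC addKr; apply/eqP => w0.
  have [x0|xn0] := eqVneq (x *m Q') 0.
    have [] := indep 1 0; last by move/eqP; rewrite oner_eq0.
    by rewrite scale1r scale0r addr0; apply: kerQ'.
  have [a ea] := wedge_eq0 w0 xn0.
  have [] := indep (- a) 1; last by move=> _ /eqP; rewrite oner_eq0.
  by apply: kerQ'; rewrite mulmxDl -!scalemxAl ea scale1r scaleNr addNr.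
have RQ : restr Q (A0 + N) = Q^T *m M1 *m Q.
  by rewrite -restrE /M1 restr_comp QQ.
have eQ : Q^T *m M1 = Q^T *m M2.
  rewrite M21 mulmxDr /wedge mulmxBr !mulmxA -!trmx_mul -!mulmxA QQ xQ yQ.
  by rewrite !trmx0 !mul0mx subrr addr0.
have := extraction (proj1 alt1) (proj1 alt2) r1 r2 eQ neq; rewrite -RQ.
have altR : alternating (restr Q (A0 + N)).
  by rewrite restrE; apply/alternating_conj/(bounded_alt bS).
move=> /(rank_even_lt altR); move: (\rank _) => r; lia.
Qed.

Lemma matching_size n t (X Y : 'M[K]_(t, n)) A0 V s :
  bounded A0 V s -> (forall i, wedge (row i X) (row i Y) \in V) ->
  row_free (col_mx X Y) -> (t <= s)%N.
Proof.
move=> bS XYV free_XY.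
have := matching_rank bS XYV free_XY (mulmx0 _ _) (mulmx0 0 _) (mem0v _).
by lia.
Qed.

End Quotient.

(** * Maximal matchings *)

Section Matching.
Variable K : fieldType.
Implicit Types n m k s t : nat.

Lemma rowspace_of n (U : {vspace 'rV[K]_n}) :
  exists A : 'M[K]_n, (forall u, (u <= A)%MS = (u \in U)) /\ \rank A = \dim U.
Proof.
exists (lin1_mx (projv U)); set A := lin1_mx _.
have AE u : u *m A = projv U u by rewrite mul_rV_lin1.
have subE u : (u <= A)%MS = (u \in U).
  apply/idP/idP => [/submxP[D ->]|uU]; first by rewrite AE memv_proj.
  by rewrite -(projv_id uU) -AE submxMl.
split=> //; pose f : 'Hom('rV[K]_(\rank A), 'rV[K]_n) := linfun (mulmxr (row_base A)).
have fE u : f u = u *m row_base A by rewrite lfunE.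
have -> : U = (f @: fullv)%VS.
  apply/vspaceP => u; rewrite -subE -(eq_row_base A).
  apply/submxP/memv_imgP => [[D ->]|[D _ ->]]; last by exists D.
  by exists D; rewrite ?memvf.
rewrite limg_dim_eq ?dimvf ?dim_matrix ?mul1r //.
apply/eqP; rewrite capfv; apply/lker0P => u v; rewrite !fE.
exact: (row_free_inj (row_base_free A)).
Qed.

Lemma row_free_geq n p q (A : 'M[K]_(p, n)) (B : 'M[K]_(q, n)) :
  row_free A -> (q <= p)%N -> (A <= B)%MS -> row_free B.
Proof.
move=> /eqP rA qp /mxrankS AB; rewrite -row_leq_rank.
by apply: leq_trans qp _; rewrite -rA.
Qed.

Lemma row_free_cons n p (z : 'rV[K]_n) (A : 'M[K]_(p, n)) :
  row_free A -> ~~ (z <= A)%MS -> row_free (col_mx z A).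
Proof.
move=> /eqP rA zA; rewrite -row_leq_rank; apply: (@leq_trans (\rank A).+1); first by rewrite rA.
apply: rank_ltmx; rewrite ltmxE -!addsmxE addsmxSr /=.
by rewrite addsmx_sub (negPf zA).
Qed.

Lemma col_mxSl n p q (A : 'M[K]_(p, n)) (B : 'M[K]_(q, n)) : (A <= col_mx A B)%MS.
Proof. by rewrite -addsmxE addsmxSl. Qed.

Lemma col_mxSr n p q (A : 'M[K]_(p, n)) (B : 'M[K]_(q, n)) : (B <= col_mx A B)%MS.
Proof. by rewrite -addsmxE addsmxSr. Qed.

Lemma not_full n p (A : 'M[K]_(p, n)) :
  (p < n)%N -> exists z : 'rV[K]_n, ~~ (z <= A)%MS.
Proof.
move=> pn; suff /row_subPn[i iA] : ~~ (1%:M <= A)%MS by exists (row i 1%:M).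
rewrite sub1mx -col_leq_rank -ltnNge.
exact: leq_ltn_trans (rank_leq_row A) pn.
Qed.

(** Linear analogue of a matching in a graph: the edges are the wedges in [V],
    and disjointness becomes linear independence of all the endpoints. *)
Definition matching n (V : {vspace 'M[K]_n}) t (X Y : 'M[K]_(t, n)) :=
  (forall i, wedge (row i X) (row i Y) \in V) /\ row_free (col_mx X Y).

Lemma max_matching n A0 (V : {vspace 'M[K]_n}) s : bounded A0 V s ->
  exists t (X Y : 'M[K]_(t, n)),
    matching V X Y /\
    forall t' (X' Y' : 'M[K]_(t', n)), matching V X' Y' -> (t' <= t)%N.
Proof.
move=> bS.
have : forall t' (X' Y' : 'M[K]_(t', n)), matching V X' Y' -> (t' <= s)%N.
  by move=> t' X' Y' [XYV /(matching_size bS XYV)].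
elim: s {bS} => [|s IH] max_s.
  exists 0%N, 0, 0; split=> //; split; first by case.
  by rewrite -row_leq_rank.
have [[X [Y mXY]]|no] := classic (exists X Y : 'M[K]_(s.+1, n), matching V X Y).
  by exists s.+1, X, Y.
apply: IH => t' X' Y' m'; have := max_s _ _ _ m'.
rewrite leq_eqVlt => /orP[/eqP e|//].
by case: no; case: _ / e; exists X', Y'.
Qed.

Section Maximal.
Variables (n : nat) (V : {vspace 'M[K]_n}) (t : nat) (X Y : 'M[K]_(t, n)).
Hypothesis mXY : matching V X Y.
Hypothesis maxXY : forall t' (X' Y' : 'M[K]_(t', n)), matching V X' Y' -> (t' <= t)%N.

Let Z := col_mx X Y.
Let free_Z : row_free Z := proj2 mXY.
Let indep (z z' : 'rV[K]_n) := row_free (col_mx z (col_mx z' Z)).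

Lemma matching_cons (z y : 'rV[K]_n) t' (X' Y' : 'M[K]_(t', n)) :
  wedge z y \in V -> (forall i, wedge (row i X') (row i Y') \in V) ->
  forall i, wedge (row i (col_mx z X')) (row i (col_mx y Y')) \in V.
Proof.
by move=> zyV XYV i; case: (split_ordP i) => j ->; rewrite ?rowKu ?rowKd ?row_id.
Qed.

(** Otherwise [wedge z y] would enlarge the matching. *)
Lemma nbr_sub z y : ~~ (z <= Z)%MS -> y \in nbr V z -> (y <= Z + z)%MS.
Proof.
rewrite mem_nbr => zZ yz; case: (boolP (y <= Z + z)%MS) => // yZz.
suff : matching V (col_mx z X) (col_mx y Y) by move/maxXY; rewrite ltnn.
split; first by apply: matching_cons => //; case: mXY.
have free_zZ := row_free_cons free_Z zZ.
have free_yzZ : row_free (col_mx y (col_mx z Z)).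
  by apply: row_free_cons; rewrite // -addsmxE addsmxC.
apply: (row_free_geq free_yzZ); first lia.
have l1 := col_mxSl (col_mx z X) (col_mx y Y).
have l2 := col_mxSr (col_mx z X) (col_mx y Y).
rewrite !col_mx_sub (submx_trans (col_mxSl y Y) l2) (submx_trans (col_mxSl z X) l1).
by rewrite (submx_trans (col_mxSr z X) l1) (submx_trans (col_mxSr y Y) l2).
Qed.

Definition symp : 'M[K]_(t + t) := block_mx 0 1%:M (- 1%:M) 0.

Lemma symp_free : row_free symp.
Proof.
apply/row_freeP; exists (block_mx 0 (- 1%:M) 1%:M 0); rewrite mulmx_block.
by rewrite !mulmx0 !mul0mx mulNmx mulmxN mulmx1 opprK !addr0 !add0r -scalar_mx_block.
Qed.

(** The symplectic form on the row space of [Z] for which the pairs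
    [row i X], [row i Y] form a symplectic basis. *)
Definition pairing (w w' : 'rV[K]_n) : 'M[K]_1 :=
  w *m pinvmx Z *m symp *m (w' *m pinvmx Z)^T.

(** Augmentation: if the [i]-th term of [pairing w w'] is nonzero, then [w] and
    [w'] can replace [row i X] and [row i Y] without changing the span, so that
    replacing the [i]-th pair by [z], [w] and [z'], [w'] gives a larger
    matching. All terms of the form thus vanish. *)
Lemma exchange z z' w w' : indep z z' ->
  (w <= Z)%MS -> w \in nbr V z -> (w' <= Z)%MS -> w' \in nbr V z' ->
  pairing w w' = 0.
Proof.
move=> zz' wZ; rewrite mem_nbr => zwV w'Z; rewrite mem_nbr => zw'V'.
rewrite /pairing; set c := w *m _; set c' := w' *m _.
have ew : w = lsubmx c *m X + rsubmx c *m Y.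
  by rewrite -mul_row_col hsubmxK mulmxKpV.
have ew' : w' = lsubmx c' *m X + rsubmx c' *m Y.
  by rewrite -mul_row_col hsubmxK mulmxKpV.
move: (lsubmx c) (rsubmx c) ew (lsubmx c') (rsubmx c') ew' (hsubmxK c) (hsubmxK c').
move=> a b ew a' b' ew' <- <-; rewrite /symp mul_row_block !mulmx0 add0r addr0.
rewrite mulmxN !mulmx1 tr_row_mx mul_row_col addrC mulNmx.
apply/matrixP=> p q; rewrite !ord1 !mxE -sumrB big1 // => i _; rewrite !mxE.
apply/eqP; case: eqP => // /eqP det0.
suff : matching V (col_mx z' (\matrix_k (if k == i then z else row k X)))
                  (col_mx w' (\matrix_k (if k == i then w else row k Y))).
  by move/maxXY; rewrite ltnn.
split; first apply: matching_cons => // k.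
  by rewrite !rowK; case: eqP => // _; case: mXY.
set X1 := \matrix_k _; set Y1 := \matrix_k _.
apply: (row_free_geq zz'); first lia.
set U := col_mx (col_mx z' X1) (col_mx w' Y1).
have z'U : (z' <= U)%MS := submx_trans (col_mxSl _ _) (col_mxSl _ _).
have w'U : (w' <= U)%MS := submx_trans (col_mxSl _ _) (col_mxSr _ _).
have X1U : (X1 <= U)%MS := submx_trans (col_mxSr _ _) (col_mxSl _ _).
have Y1U : (Y1 <= U)%MS := submx_trans (col_mxSr _ _) (col_mxSr _ _).
have zU : (z <= U)%MS.
  by apply: submx_trans X1U; rewrite -[z](_ : row i X1 = z) ?row_sub // rowK eqxx.
have wU : (w <= U)%MS.
  by apply: submx_trans Y1U; rewrite -[w](_ : row i Y1 = w) ?row_sub // rowK eqxx.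
have XkU (k : 'I_t) : k != i -> (row k X <= U)%MS.
  move=> ki; apply: submx_trans X1U.
  by rewrite -[row k X](_ : row k X1 = _) ?row_sub // rowK (negPf ki).
have YkU (k : 'I_t) : k != i -> (row k Y <= U)%MS.
  move=> ki; apply: submx_trans Y1U.
  by rewrite -[row k Y](_ : row k Y1 = _) ?row_sub // rowK (negPf ki).
have at_i (d e : 'rV_t) : (((d *m X + e *m Y)%R : 'rV_n) <= U)%MS ->
    ((d 0 i *: row i X + e 0 i *: row i Y)%R <= U)%MS.
  move=> de; rewrite !mulmx_sum_row (bigD1 i) //= [X in (_ + X)%R](bigD1 i) //= in de.
  rewrite addrACA in de.
  rewrite -[X in (X <= _)%MS](addrK (\sum_(k | k != i) d 0 k *: row k X +
     \sum_(k | k != i) e 0 k *: row k Y)).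
  rewrite addmx_sub // eqmx_opp addmx_sub // summx_sub // => k ki; rewrite scalemx_sub //.
    exact: XkU.
  exact: YkU.
have i1 := at_i a b; rewrite -ew in i1; move: {i1}(i1 wU) => i1.
have i2 := at_i a' b'; rewrite -ew' in i2; move: {i2}(i2 w'U) => i2.
have Xi : (row i X <= U)%MS.
  have : ((b' 0 i *: (a 0 i *: row i X + b 0 i *: row i Y)
     - b 0 i *: (a' 0 i *: row i X + b' 0 i *: row i Y))%R <= U)%MS.
    by rewrite addmx_sub ?eqmx_opp ?scalemx_sub.
  rewrite [X in (X <= _)%MS](_ : _ = (a 0 i * b' 0 i - b 0 i * a' 0 i) *: row i X); last first.
    by apply/rowP=> k; rewrite !mxE; ring.
  by rewrite (eqmx_scale _ det0).
have Yi : (row i Y <= U)%MS.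
  have : ((a 0 i *: (a' 0 i *: row i X + b' 0 i *: row i Y)
     - a' 0 i *: (a 0 i *: row i X + b 0 i *: row i Y))%R <= U)%MS.
    by rewrite addmx_sub ?eqmx_opp ?scalemx_sub.
  rewrite [X in (X <= _)%MS](_ : _ = (a 0 i * b' 0 i - b 0 i * a' 0 i) *: row i Y); last first.
    by apply/rowP=> k; rewrite !mxE; ring.
  by rewrite (eqmx_scale _ det0).
have XU : (X <= U)%MS.
  by apply/row_subP => k; have [->|/XkU] := eqVneq k i.
have YU : (Y <= U)%MS.
  by apply/row_subP => k; have [->|/YkU] := eqVneq k i.
by rewrite !col_mx_sub zU z'U XU YU.
Qed.

(** The form is nondegenerate on a space of dimension [2 * t]. *)
Lemma rank_orthogonal p q (A : 'M[K]_(p, n)) (B : 'M[K]_(q, n)) :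
  (A <= Z)%MS -> (B <= Z)%MS ->
  (forall u v, (u <= A)%MS -> (v <= B)%MS -> pairing u v = 0) ->
  (\rank A + \rank B <= t.*2)%N.
Proof.
move=> AZ BZ orth; rewrite -(mulmxKpV AZ) -(mulmxKpV BZ) !(mxrankMfree _ free_Z).
rewrite -(mxrankMfree _ symp_free) -(mxrank_tr (B *m _)) -addnn.
apply: mulmx0_rank_max; apply/matrixP => i j.
have := orth _ _ (row_sub i A) (row_sub j B); rewrite /pairing -!row_mul.
move/matrixP/(_ 0 0); rewrite !mxE => e0; rewrite -[RHS]e0.
by apply: eq_bigr => k _; rewrite !mxE.
Qed.

Lemma nbr_matrix z : ~~ (z <= Z)%MS ->
  exists T : 'M[K]_n, [/\ (T <= Z)%MS, forall w, (w <= T)%MS -> w \in nbr V z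
    & (\dim (nbr V z) <= (\rank T).+1)%N].
Proof.
move=> zZ; have [A [AE <-]] := rowspace_of (nbr V z).
exists (A :&: Z)%MS; split; rewrite ?capmxSr //.
  by move=> w wA; rewrite -AE (submx_trans wA) ?capmxSl.
have zA : (z <= A)%MS by rewrite AE nbrxx.
have AZz : (A <= Z + z)%MS.
  by apply/row_subP => i; apply: nbr_sub; rewrite // -AE row_sub.
have : (A <= A :&: Z + z)%MS.
  by rewrite (matrix_modr Z zA) sub_capmx submx_refl.
move/mxrankS/leq_trans; apply; apply: leq_trans (mxrank_adds_leqif _ _) _.
by rewrite rank_rV; case: eqP; lia.
Qed.

Lemma nbr_orthogonal p q (T : 'M[K]_(p, n)) (T' : 'M[K]_(q, n)) z z' :
  indep z z' -> (T <= Z)%MS -> (T' <= Z)%MS ->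
  (forall w, (w <= T)%MS -> w \in nbr V z) ->
  (forall w, (w <= T')%MS -> w \in nbr V z') ->
  forall u v, (u <= T)%MS -> (v <= T')%MS -> pairing u v = 0.
Proof.
move=> zz' TZ T'Z Tz T'z u v uT vT'; apply: (exchange zz').
- exact: submx_trans uT TZ.
- exact: Tz.
- exact: submx_trans vT' T'Z.
- exact: T'z.
Qed.

Lemma indep_sub z z' : indep z z' -> ~~ (z <= Z)%MS /\ ~~ (z' <= Z)%MS.
Proof.
rewrite /indep => free_zz'; split; apply: contraL free_zz' => zZ.
  rewrite -row_leq_rank -ltnNge.
  have /mxrankS : (col_mx z (col_mx z' Z) <= col_mx z' Z)%MS.
    by rewrite col_mx_sub submx_refl (submx_trans zZ) ?col_mxSr.
  move/leq_ltn_trans; apply; apply: leq_ltn_trans (rank_leq_row _) _; lia.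
rewrite -row_leq_rank -ltnNge.
have /mxrankS : (col_mx z (col_mx z' Z) <= col_mx z Z)%MS.
  by rewrite 2!col_mx_sub col_mxSl col_mxSr (submx_trans zZ) ?col_mxSr.
move/leq_ltn_trans; apply; apply: leq_ltn_trans (rank_leq_row _) _; lia.
Qed.

Lemma dim_nbr_add z z' : indep z z' ->
  (\dim (nbr V z) + \dim (nbr V z') <= t.*2 + 2)%N.
Proof.
move=> zz'; have [zZ z'Z] := indep_sub zz'.
have [T [TZ Tz dT]] := nbr_matrix zZ; have [T' [T'Z T'z dT']] := nbr_matrix z'Z.
have := rank_orthogonal TZ T'Z (nbr_orthogonal zz' TZ T'Z Tz T'z).
move: dT dT'; move: (\dim _) (\dim _) (\rank _) (\rank _); lia.
Qed.

Lemma indep_exists : (t.*2 + 2 <= n)%N -> exists z z', indep z z'.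
Proof.
move=> tn; have [z' z'Z] : exists z' : 'rV_n, ~~ (z' <= Z)%MS.
  by apply: not_full; lia.
have [z zZ] : exists z : 'rV_n, ~~ (z <= col_mx z' Z)%MS.
  by apply: not_full; lia.
by exists z, z'; apply: row_free_cons => //; apply: row_free_cons.
Qed.

(** Equality case of [dim_nbr_add]: the traces on [Z] of the neighbourhoods of
    the vectors outside of [Z] are Lagrangian, and those of two independent
    vectors are orthogonal, hence equal since each is its own orthogonal.
    In terms of ranks: traces [T'] and [T''] are equal as soon as both are
    orthogonal to the same [T], and applying this to [z], [z'] and [z + z']
    compares any two independent vectors. The common trace [T] is joined to
    every vector outside of [Z], and these vectors span. *)
Lemma common_nbr : (t.*2 + 2 <= n)%N ->
  (forall z, z != 0 -> (t < \dim (nbr V z))%N) ->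
  exists T : 'M[K]_n, \rank T = t /\ forall w u, (w <= T)%MS -> wedge w u \in V.
Proof.
move=> tn big.
have nz (z : 'rV_n) : ~~ (z <= Z)%MS -> z != 0 by apply: contraNneq => ->; apply: sub0mx.
have [z0 [z1 z01]] := indep_exists tn.
have [z0Z z1Z] := indep_sub z01.
have [T0 [T0Z T0z dT0]] := nbr_matrix z0Z.
have rT0 : (t <= \rank T0)%N by rewrite -ltnS (leq_trans (big _ (nz _ z0Z)) dT0).
have indepC z z' : indep z z' -> indep z' z.
  rewrite /indep => f; apply: (row_free_geq f) => //.
  rewrite 2!col_mx_sub col_mxSl (submx_trans (col_mxSl z Z)) ?col_mxSr //=.
  by rewrite (submx_trans (col_mxSr z Z)) ?col_mxSr.
have indepD z z' : indep z z' -> indep z (z + z').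
  rewrite /indep => f; apply: (row_free_geq f) => //.
  rewrite 2!col_mx_sub col_mxSl /=.
  rewrite (submx_trans (col_mxSr (z + z')%R Z)) ?col_mxSr // andbT.
  rewrite -[z' in (z' <= _)%MS](addKr z) addmx_sub // ?eqmx_opp ?col_mxSl //.
  by rewrite (submx_trans (col_mxSl (z + z')%R Z)) ?col_mxSr.
(* T' + T'' is orthogonal to T, so its rank is at most t. *)
have share (T T' T'' : 'M_n) z z' z'' : indep z z' -> indep z z'' ->
    (T <= Z)%MS -> (T' <= Z)%MS -> (T'' <= Z)%MS ->
    (forall w, (w <= T)%MS -> w \in nbr V z) ->
    (forall w, (w <= T')%MS -> w \in nbr V z') ->
    (forall w, (w <= T'')%MS -> w \in nbr V z'') ->
    (t <= \rank T)%N -> (t <= \rank T')%N -> (t <= \rank T'')%N ->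
    (T' <= T'')%MS.
  move=> zz' zz'' TZ T'Z T''Z Tz T'z T''z rT rT' rT''.
  have o' := nbr_orthogonal zz' TZ T'Z Tz T'z.
  have o'' := nbr_orthogonal zz'' TZ T''Z Tz T''z.
  have : (\rank T + \rank (T' + T'')%MS <= t.*2)%N.
    apply: rank_orthogonal; rewrite // ?addsmx_sub ?T'Z // => u v uT.
    case/sub_addsmxP => -[a b] /= ->; rewrite /pairing mulmxDl linearD mulmxDr /=.
    by rewrite -/(pairing u (a *m T')) -/(pairing u (b *m T'')) o' ?o'' ?addr0 ?submxMl.
  move=> r; have sub : (T'' <= T' + T'')%MS by apply: addsmxSr.
  have : (T' + T'' <= T'')%MS.
    rewrite -(geq_leqif (mxrank_leqif_sup sub)).
    apply: leq_trans rT''; rewrite -(leq_add2l t) addnn; apply: leq_trans r.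
    by rewrite leq_add2r.
  by rewrite addsmx_sub => /andP[].
have swap z z' (T T' : 'M_n) : indep z z' ->
    (T <= Z)%MS -> (T' <= Z)%MS ->
    (forall w, (w <= T)%MS -> w \in nbr V z) ->
    (forall w, (w <= T')%MS -> w \in nbr V z') ->
    (t <= \rank T)%N -> (t <= \rank T')%N -> (T <= T')%MS.
  move=> zz' TZ T'Z Tz T'z rT rT'.
  have [_ z2Z] := indep_sub (indepD _ _ zz').
  have [T2 [T2Z T2z dT2]] := nbr_matrix z2Z.
  have rT2 : (t <= \rank T2)%N by rewrite -ltnS (leq_trans (big _ (nz _ z2Z)) dT2).
  have T2T' : (T2 <= T')%MS.
    by apply: (share T T2 T' z (z + z') z') => //; apply: indepD.
  have TT2 : (T <= T2)%MS.
    apply: (share T' T T2 z' z (z + z')) => //; first exact: indepC.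
    by rewrite addrC; apply/indepD/indepC.
  exact: submx_trans TT2 T2T'.
have [T1 [T1Z T1z dT1]] := nbr_matrix z1Z.
have rT1 : (t <= \rank T1)%N by rewrite -ltnS (leq_trans (big _ (nz _ z1Z)) dT1).
have T01 : (T0 <= T1)%MS by apply: (swap z0 z1).
have rank_T0 : \rank T0 = t.
  have := rank_orthogonal T0Z T1Z (nbr_orthogonal z01 T0Z T1Z T0z T1z).
  clear -rT0 rT1; move: (\rank T0) (\rank T1) rT0 rT1; lia.
exists T0; split=> // w u wT0.
have outside z : ~~ (z <= Z)%MS -> w \in nbr V z.
  move=> zZ; have [T [TZ Tz dT]] := nbr_matrix zZ.
  have rT : (t <= \rank T)%N by rewrite -ltnS (leq_trans (big _ (nz _ zZ)) dT).
  apply: (Tz); have [zz0|zz0] := boolP (indep z z0).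
    by apply: submx_trans wT0 _; apply: (swap z0 z) => //; apply: indepC.
  have [zz1|zz1] := boolP (indep z z1).
    apply: (submx_trans (submx_trans wT0 T01)).
    by apply: (swap z1 z) => //; apply: indepC.
  have zz0' : (z <= col_mx z0 Z)%MS.
    by apply: contraNT zz0 => /(row_free_cons (row_free_cons free_Z z0Z)).
  have zz1' : (z <= col_mx z1 Z)%MS.
    by apply: contraNT zz1 => /(row_free_cons (row_free_cons free_Z z1Z)).
  case/negP: zZ.
  move: zz0' zz1' => /submxP[D eD] /submxP[E eE].
  move: eE; rewrite eD -[D]hsubmxK -[E]hsubmxK !mul_row_col.
  rewrite [lsubmx D]mx11_scalar mul_scalar_mx.
  have [->|d0] := eqVneq (lsubmx D 0 0) 0; first by rewrite scale0r add0r submxMl.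
  move=> e; have : (z0 <= col_mx z1 Z)%MS.
    rewrite -(eqmx_scale z0 d0) -[_ *: z0](addrK (rsubmx D *m Z)) e.
    rewrite !addmx_sub ?eqmx_opp // mulmx_sub // ?col_mxSl ?col_mxSr //.
  move: z01; rewrite /indep => f sub; suff : (1 + (1 + (t + t)) <= 1 + (t + t))%N by rewrite ltnn.
  rewrite -{1}(eqP f); apply: leq_trans (rank_leq_row (col_mx z1 Z)); apply: mxrankS.
  by rewrite col_mx_sub sub submx_refl.
have [uZ|/outside] := boolP (u <= Z)%MS; last by rewrite nbrC mem_nbr.
rewrite -mem_nbr nbrC nbrC -[u](addrK z0) memvB //; last by rewrite nbrC outside.
rewrite nbrC outside //; apply: contraNN z0Z => uz0.
by rewrite -[z0](addKr u) addmx_sub // eqmx_opp.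
Qed.

End Maximal.

(** In a graph without [s + 1] disjoint edges and with at least [2 * s + 2]
    vertices, some vertex has degree at most [s]. *)
Lemma low_degree n A0 (V : {vspace 'M[K]_n}) s :
  bounded A0 V s -> (s.*2 + 2 <= n)%N ->
  exists2 z, z != 0 & (\dim (nbr V z) <= s.+1)%N.
Proof.
move=> bS sn; have [t [X [Y [mXY maxXY]]]] := max_matching bS.
have ts : (t <= s)%N by case: mXY => XYV /(matching_size bS XYV).
have [|z [z' zz']] := @indep_exists n V t X Y mXY; first lia.
have := dim_nbr_add mXY maxXY zz'; have [zZ z'Z] := indep_sub mXY zz'.
have nz (u : 'rV_n) : ~~ (u <= col_mx X Y)%MS -> u != 0.
  by apply: contraNneq => ->; apply: sub0mx.
have [dz|dz] := leqP (\dim (nbr V z)) s.+1 => d; first by exists z => //; apply: nz.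
exists z'; first exact: nz.
move: dz d; move: (\dim _) (\dim _); lia.
Qed.

Lemma saturated n A0 (V : {vspace 'M[K]_n}) s :
  bounded A0 V s -> (s.*2 + 2 <= n)%N ->
  (forall z, z != 0 -> (s < \dim (nbr V z))%N) ->
  exists T : 'M[K]_n, \rank T = s /\ forall w u, (w <= T)%MS -> wedge w u \in V.
Proof.
move=> bS sn big; have [t [X [Y [mXY maxXY]]]] := max_matching bS.
have ts : (t <= s)%N by case: mXY => XYV /(matching_size bS XYV).
have et : t = s.
  have [|z [z' zz']] := @indep_exists n V t X Y mXY; first lia.
  have := dim_nbr_add mXY maxXY zz'; have [zZ z'Z] := indep_sub mXY zz'.
  have nz (u : 'rV_n) : ~~ (u <= col_mx X Y)%MS -> u != 0.
    by apply: contraNneq => ->; apply: sub0mx.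
  have := big _ (nz _ zZ); have := big _ (nz _ z'Z).
  move: (\dim _) (\dim _); lia.
by move: et X Y mXY maxXY => -> X Y mXY maxXY; apply: (common_nbr mXY maxXY).
Qed.

End Matching.

(** * The bound on the dimension *)

Definition maxdim n s := maxn (a1 n (2 * s)) (a2 n (2 * s)).

Lemma a1E n s : a1 n (2 * s) = (s * (2 * s + 1))%N.
Proof.
rewrite /a1 bin2 /=.
by have -> : ((2 * s).+1 * (2 * s) = (s * (2 * s + 1)).*2)%N; [nia | rewrite doubleK].
Qed.

Lemma a2E n s : (2 * a2 n (2 * s) = s * s.-1 + 2 * s * (n - s))%N.
Proof.
rewrite /a2; have -> : ((2 * s)./2 = s)%N by rewrite mul2n doubleK.
rewrite mulnDr bin2; have := odd_double_half (s * s.-1).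
have : ~~ odd (s * s.-1) by case: s => //= s; rewrite oddM /= andNb.
by move=> /negPf ->; lia.
Qed.

(** The right-hand side of the recursion [two_step] stays below the bound, and
    reaches it only when the second term of the maximum realizes it. *)
Lemma maxdim_step n s : (0 < s)%N -> (2 * s + 2 <= n.+2)%N ->
  (maxdim n s.-1 + s + n <= a2 n.+2 (2 * s))%N \/
  (maxdim n s.-1 + s + n < a1 n.+2 (2 * s))%N.
Proof.
case: s => // s _ sn; rewrite /maxdim /=.
have := a1E n s; have := a1E n.+2 s.+1; have := a2E n s; have := a2E n.+2 s.+1.
move: (a1 _ _) (a1 _ _) (a2 _ _) (a2 _ _) => x y z t.
rewrite /maxn; have [m ->] : exists m, n = (2 * s + m)%N by exists (n - 2 * s)%N; lia.
have -> : ((2 * s + m).+2 - s.+1 = s + m.+1)%N by lia.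
have -> : (2 * s + m - s = s + m)%N by lia.
case: s sn => [|s] _ /=; case: ltnP; nia.
Qed.

Lemma a2_leq n s : (a2 n (2 * s) <= a2 n.+1 (2 * s))%N.
Proof.
by rewrite -(leq_pmul2l (isT : 0 < 2)%N) !a2E leq_add2l leq_mul2l leq_sub2r ?orbT.
Qed.

Lemma maxdim_pred n s : (maxdim n s <= maxdim n.+1 s)%N.
Proof.
by rewrite /maxdim geq_max leq_maxl (leq_trans (a2_leq n s)) ?leq_maxr.
Qed.

Lemma a2_ltn n s : (0 < s)%N -> (s <= n)%N -> (a2 n (2 * s) < a2 n.+1 (2 * s))%N.
Proof.
move=> s0 sn; rewrite -(ltn_pmul2l (isT : 0 < 2)%N) !a2E ltn_add2l ltn_pmul2l; lia.
Qed.

Lemma maxdim_full s : maxdim (2 * s).+1 s = 'C((2 * s).+1, 2).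
Proof.
apply/maxn_idPl; have := a1E (2 * s).+1 s; have := a2E (2 * s).+1 s.
move: (a1 _ _) (a2 _ _) => x y.
have -> : ((2 * s).+1 - s = s.+1)%N by lia.
case: s => [|s] /=; nia.
Qed.

Section Bound.
Variable K : fieldType.

Lemma extraction_step n (x y : 'rV[K]_n) m (Q : 'M[K]_(n, m)) A0 V s :
  bounded A0 V s -> x != 0 -> y \notin <[x]>%VS -> wedge x y \in V ->
  x *m Q = 0 -> y *m Q = 0 ->
  (0 < s)%N /\ bounded (restr Q A0) (restr Q @: V)%VS s.-1.
Proof.
move=> bS x0 yx xyV xQ yQ.
have rk N : N \in V -> (\rank (restr Q (A0 + N)%R) + 2 <= s.*2)%N.
  move=> NV; have := @matching_rank _ _ 1 x y _ Q _ _ _ N bS.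
  apply=> //; first by move=> i; rewrite !row_id.
  have fy : row_free y by rewrite row_free_rV; apply: contraNneq yx => ->; apply: mem0v.
  apply: (row_free_cons fy); apply: contra yx => /sub_rVP[a ea].
  have a0 : a != 0 by apply: contraNneq x0 => a0; rewrite ea a0 scale0r.
  by apply/vlineP; exists a^-1; rewrite ea scalerA mulVf // scale1r.
have s0 : (0 < s)%N by have := rk _ (mem0v V); case: (s) => //; lia.
split=> //; have [altA altV _] := bounded_restr Q bS; split=> // _ /memv_imgP[N NV ->].
by have := rk N NV; rewrite restrD; move: (\rank _); lia.
Qed.

(** Quotient by [z], then by a neighbour [y] of [z]: the first costs the degree
    of [z], the second at most [n], and [extraction_step] lowers the rank. *)
Lemma two_step n (A0 : 'M[K]_n.+2) V s z d :
  bounded A0 V s -> z != 0 -> (1 < \dim (nbr V z))%N ->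
  ((0 < s)%N -> forall (B0 : 'M[K]_n) W, bounded B0 W s.-1 -> (\dim W <= d)%N) ->
  (0 < s)%N /\ ((\dim V).+1 <= \dim (nbr V z) + n + d)%N.
Proof.
move=> bS z0 dz IH.
have [Q pQ] := proj_along_exists z0.
have [y yz yV] : exists2 y, y \notin <[z]>%VS & wedge z y \in V.
  have /subvPn[y] : ~~ (nbr V z <= <[z]>)%VS.
    by apply: contraL dz => /dimvS; rewrite dim_vline z0; move: (\dim _); lia.
  by rewrite mem_nbr => yV yz; exists y.
pose y1 := y *m Q.
have y10 : y1 != 0 by apply: contraNneq yz => /(proj_along_ker pQ).
have [Q2 pQ2] := proj_along_exists y10.
have [s0 bS2] : (0 < s)%N /\ bounded (restr (Q *m Q2) A0) (restr (Q *m Q2) @: V)%VS s.-1.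
  apply: (extraction_step bS z0 yz yV); rewrite mulmxA; first by rewrite (proj1 pQ) mul0mx.
  exact: (proj1 pQ2).
split=> //; have [_ altV _] := bS.
have dV := dim_quotient z0 pQ altV.
have altV1 := restr_alt Q altV.
have dV1 := dim_quotient y10 pQ2 altV1.
have := IH s0 _ _ bS2.
have -> : (restr (Q *m Q2) @: V = restr Q2 @: (restr Q @: V))%VS.
  rewrite -limg_comp; apply: eq_in_limg => N _; rewrite comp_lfunE /=.
  by rewrite restr_comp.
have := dim_nbr (restr Q @: V) y1.
move: dV dV1; move: (\dim _) (\dim _) (\dim _) (\dim _) (\dim _) => a b c e f; lia.
Qed.

(** Same induction as for graphs: a vector of degree 0 is removed, and when
    there is none, a vector of low degree is removed together with one of its
    neighbours. *)
Lemma dim_bound n s (A0 : 'M[K]_n) V :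
  bounded A0 V s -> (2 * s < n)%N -> (\dim V <= maxdim n s)%N.
Proof.
have [m] := ubnP n; elim: m => // m IH in n s A0 V *.
rewrite ltnS => nm bS sn; have [_ altV _] := bS.
move: sn; rewrite leq_eqVlt => /orP[/eqP e|sn].
  by apply: leq_trans (dim_alt altV) _; rewrite -e maxdim_full.
case: n => [|[|n]] in A0 V nm bS altV sn *; [lia | lia | ].
have [[z [z0 dz]]|no] := classic (exists z, z != 0 /\ (\dim (nbr V z) <= 1)%N).
  have [Q pQ] := proj_along_exists z0.
  have := dim_quotient z0 pQ altV.
  have := IH _ _ _ _ _ (bounded_restr Q bS).
  move=> /(_ nm sn); have := maxdim_pred n.+1 s.
  move: dz; move: (maxdim _ _) (maxdim _ _) (\dim _) (\dim _) (\dim _); lia.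
have [|z z0 dz] := low_degree bS; first lia.
have dz1 : (1 < \dim (nbr V z))%N by rewrite ltnNge; apply/negP => le1; case: no; exists z.
have [|s0 dV] := two_step bS z0 dz1 (d := maxdim n s.-1).
  by move=> s0 B0 W bW; apply: (IH _ _ _ _ _ bW); lia.
have m2 : (a2 n.+2 (2 * s) <= maxdim n.+2 s)%N by apply: leq_maxr.
have m1 : (a1 n.+2 (2 * s) <= maxdim n.+2 s)%N by apply: leq_maxl.
have := @maxdim_step n s s0; rewrite -addn2 in sn *.
move: dV dz; move: (\dim _) (\dim _) => d d' dV dz; lia.
Qed.

(** Removing vectors of degree 0 keeps the dimension: either this can be done
    until [(2 * s).+1] coordinates remain, in which case [V] is identified with
    the space of all alternating matrices of that size, or all degrees are
    positive at some stage. The latter can only be the first stage, as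
    [a2_ltn] shows, and then [two_step] forces all degrees to be at least [s],
    so that [saturated] applies. *)
Lemma dim_extremal n s (A0 : 'M[K]_n) V :
  bounded A0 V s -> (2 * s < n)%N -> (0 < s)%N -> \dim V = maxdim n s ->
  ((2 * s + 2 <= n)%N /\ maxdim n s = a2 n (2 * s) /\
    exists T : 'M[K]_n, \rank T = s /\ forall w u, (w <= T)%MS -> wedge w u \in V) \/
  (\dim V = 'C((2 * s).+1, 2) /\
    exists Q : 'M[K]_(n, (2 * s).+1),
      forall N, N \in V -> restr Q N = 0 -> N = 0).
Proof.
have [m] := ubnP n; elim: m => // m IH in n A0 V *.
rewrite ltnS => nm bS sn s0 dV; have [_ altV _] := bS.
move: sn; rewrite leq_eqVlt => /orP[/eqP e|sn].
  right; split; first by rewrite dV -e maxdim_full.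
  suff [Q kerQ] : exists Q : 'M[K]_(n, (2 * s).+1), forall N, restr Q N = 0 -> N = 0.
    by exists Q => N _; apply: kerQ.
  clear -e; case: n / e; exists 1%:M => N.
  by rewrite restrE trmx1 mul1mx mulmx1.
case: n => [|[|n]] in A0 V nm bS altV sn dV *; [lia | lia | ].
have [[z [z0 dz]]|no] := classic (exists z, z != 0 /\ (\dim (nbr V z) <= 1)%N).
  right; have [Q pQ] := proj_along_exists z0.
  have dQ := dim_quotient z0 pQ altV.
  have bQ := bounded_restr Q bS.
  have dW : \dim (restr Q @: V) = \dim V.
    have := limg_ker_dim (restr Q) V; move: dQ dz.
    by move: (\dim _) (\dim _) (\dim _) (\dim _); lia.
  have eM : maxdim n.+1 s = maxdim n.+2 s.
    by apply/eqP; rewrite eqn_leq maxdim_pred -dV -dW (dim_bound bQ).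
  have ker0 N : N \in V -> restr Q N = 0 -> N = 0.
    move=> NV N0; apply/eqP; rewrite -memv0.
    suff <- : (V :&: lker (restr Q) = 0)%VS by rewrite memv_cap NV memv_ker N0 eqxx.
    apply/eqP; rewrite -dimv_eq0; have := limg_ker_dim (restr Q) V.
    rewrite dW; move: (\dim _) (\dim _) => d d'; lia.
  (* The first case would give maxdim n.+1 s = a2 n.+1 < a2 n.+2 <= maxdim n.+2 s. *)
  case: (IH _ _ _ nm bQ sn s0); first by rewrite dW dV eM.
    case=> _ [ea2 _]; have := @a2_ltn n.+1 s s0.
    by rewrite -ea2 eM ltnNge leq_maxr => H; have := H ltac:(lia).
  case=> dW' [Q' ker0']; rewrite -dW; split=> //; exists (Q *m Q') => N NV.
  by rewrite -restr_comp => /(ker0' _ (memv_img _ NV)); apply: ker0.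
left; split; first by lia.
have step z : z != 0 -> ((maxdim n.+2 s).+1 <= \dim (nbr V z) + n + maxdim n s.-1)%N.
  move=> z0; have dz1 : (1 < \dim (nbr V z))%N.
    by rewrite ltnNge; apply/negP => le1; case: no; exists z.
  have [|_] := two_step bS z0 dz1 (d := maxdim n s.-1); last by rewrite dV.
  by move=> _ B0 W bW; apply: (dim_bound bW); lia.
have m2 : (a2 n.+2 (2 * s) <= maxdim n.+2 s)%N by apply: leq_maxr.
have m1 : (a1 n.+2 (2 * s) <= maxdim n.+2 s)%N by apply: leq_maxl.
have num : (maxdim n s.-1 + s + n <= a2 n.+2 (2 * s))%N \/
  (maxdim n s.-1 + s + n < a1 n.+2 (2 * s))%N by apply: maxdim_step => //; lia.
split.
  have [|z z0 dz] := low_degree bS; first lia.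
  have := step z z0; move: (\dim _) dz => d dz; lia.
apply: (saturated bS); first lia.
move=> z z0; have := step z z0; move: (\dim _) => d; lia.
Qed.

End Bound.

(** * The spaces congruent to WA *)

Section Classify.
Variable K : fieldType.

Lemma sum_wedge n p (X G : 'M[K]_(p, n)) :
  X^T *m G - G^T *m X = \sum_i wedge (row i X) (row i G).
Proof.
apply/matrixP => i j; rewrite summxE !mxE -sumrB; apply: eq_bigr => k _.
by rewrite wedgeE !mxE.
Qed.

(** If the rows of [X] are joined to every vector, they can be matched with any
    [s] independent vectors, in particular inside the kernel of two linear forms
    that vanish on [X]: this kernel has dimension at least [2 * s]. By
    [matching_rank], these two forms are then orthogonal for every matrix of
    the affine space. *)
Lemma restr_joined_eq0 n s (A0 : 'M[K]_n) V (X : 'M[K]_(s, n)) m (Q : 'M[K]_(n, m)) N :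
  bounded A0 V s -> (2 * s + 2 <= n)%N -> row_free X ->
  (forall i u, wedge (row i X) u \in V) -> X *m Q = 0 -> N \in V ->
  restr Q (A0 + N) = 0.
Proof.
move=> bS sn free_X XV XQ NV; apply/matrixP => i j.
pose a := col i Q; pose b := col j Q; pose Qab := row_mx a b.
have XQab : X *m Qab = 0.
  by rewrite mul_mx_row /a /b !colE !mulmxA XQ !mul0mx row_mx0.
pose D := (kermx Qab :\: X)%MS.
have Xker : (X <= kermx Qab)%MS by apply/sub_kermxP.
have rX : \rank X = s by apply/eqP.
have rD : (s <= \rank D)%N.
  have rker : (n - 2 <= \rank (kermx Qab))%N.
    by rewrite mxrank_ker leq_sub2l // rank_leq_col.
  have := mxrank_cap_compl (kermx Qab) X.
  have : (\rank (kermx Qab :&: X)%MS <= s)%N by rewrite -[X in (_ <= X)%N]rX mxrankS ?capmxSr.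
  rewrite -/D; move: rker sn; move: (\rank _) (\rank _) (\rank _); lia.
pose Y : 'M_(s, n) := pid_mx s *m row_base D.
have YD : (Y <= D)%MS by rewrite -(eq_row_base D) submxMl.
have rY : \rank Y = s by rewrite mxrankMfree ?row_base_free // rank_pid_mx.
have free_XY : row_free (col_mx X Y).
  rewrite -row_leq_rank -addsmxE mxrank_disjoint_sum ?rX ?rY //.
  apply/eqP; rewrite -submx0 -(capmx_diff (kermx Qab) X) sub_capmx capmxSl andbT.
  exact: submx_trans (capmxSr _ _) YD.
have YQ : Y *m Qab = 0.
  by apply/sub_kermxP; apply: submx_trans YD _; apply: diffmxSl.
have := matching_rank bS (fun i => XV i (row i Y)) free_XY XQab YQ NV.
rewrite -{2}[s.*2]add0n leq_add2r leqn0 mxrank_eq0 restrE => /eqP.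
rewrite tr_row_mx mul_col_mx mul_col_row -block_mx0 => /eq_block_mx[_ e _ _].
move/matrixP/(_ 0 0): e; rewrite [X in _ = X]mxE => e.
rewrite restrE [RHS]mxE -[RHS]e.
rewrite /a /b tr_col -row_mul !mxE.
by apply: eq_bigr => k _; rewrite !mxE.
Qed.

(** In a basis that starts with the rows of [X], [kill] says that the lower
    right block is 0; conversely, every matrix of this shape is a sum of
    wedges with a row of [X]. *)
Lemma congruent_WA s k (S : 'M[K]_(s + k) -> Prop) A0 (V : {vspace 'M[K]_(s + k)})
    (X : 'M[K]_(s, s + k)) :
  (forall A, S A <-> A - A0 \in V) -> (forall A, S A -> alternating A) ->
  row_free X -> (forall i u, wedge (row i X) u \in V) ->
  (forall A m (Q : 'M[K]_(s + k, m)), S A -> X *m Q = 0 -> restr Q A = 0) ->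
  congruent S (fun M : 'M[K]_(s + k) => exists (A : 'M[K]_s) (B : 'M[K]_(s, k)),
    alternating A /\ M = block_mx A B (- B^T) 0).
Proof.
move=> hS altS free_X XV kill.
have [Y [Q [R [_ XQ RQ uP YQ]]]] := quotient_maps free_X.
have fwd A : S A -> exists2 B, (exists (A1 : 'M[K]_s) (B1 : 'M[K]_(s, k)),
    alternating A1 /\ B = block_mx A1 B1 (- B1^T) 0) & A = (col_mx X R)^T *m B *m (col_mx X R)^T^T.
  move=> SA; have [At _] := altS _ SA.
  exists ((row_mx Y Q)^T *m A *m row_mx Y Q).
    exists (Y^T *m A *m Y), (Y^T *m A *m Q); split; first exact/alternating_conj/altS.
    rewrite tr_row_mx mul_col_mx mul_col_row -[Q^T *m A *m Q]restrE kill //.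
    by rewrite !trmx_mul trmxK At mulNmx mulmxN opprK mulmxA.
  rewrite trmxK !mulmxA -trmx_mul -!mulmxA mul_row_col YQ mulmx1.
  by rewrite trmx1 mul1mx.
have bwd (A1 : 'M_s) B1 : alternating A1 ->
    (col_mx X R)^T *m block_mx A1 B1 (- B1^T) 0 *m (col_mx X R) \in V.
  case/alternatingP=> A2 ->.
  pose G := A2 *m X + B1 *m R.
  suff -> : (col_mx X R)^T *m block_mx (A2 - A2^T) B1 (- B1^T) 0 *m (col_mx X R) = X^T *m G - G^T *m X.
    by rewrite sum_wedge memv_suml.
  have -> : G^T = X^T *m A2^T + R^T *m B1^T by rewrite linearD /= !trmx_mul.
  rewrite tr_col_mx mul_row_block mulmx0 addr0 mul_row_col /G.
  rewrite mulmxBr mulmxN !mulmxDr !mulmxDl !mulNmx !mulmxA opprD.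
  by rewrite addrAC -!addrA; congr (_ + _); rewrite addrCA.
exists (col_mx X R)^T; first by rewrite unitmx_tr.
move=> A; split; first exact: fwd.
case=> B [A1 [B1 [altA1 ->]]] ->; apply/hS; rewrite trmxK memvB ?bwd //.
have SA0 : S A0 by apply/hS; rewrite subrr mem0v.
by have [_ [A2 [B2 [altA2 ->]]] ->] := fwd _ SA0; rewrite trmxK bwd.
Qed.

Lemma congruent_WA_cast s k n (e : (s + k = n)%N) (S : 'M[K]_n -> Prop) A0
    (V : {vspace 'M[K]_n}) (X : 'M[K]_(s, n)) :
  (forall A, S A <-> A - A0 \in V) -> (forall A, S A -> alternating A) ->
  row_free X -> (forall i u, wedge (row i X) u \in V) ->
  (forall A m (Q : 'M[K]_(n, m)), S A -> X *m Q = 0 -> restr Q A = 0) ->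
  congruent S (cast_set e (fun M : 'M[K]_(s + k) => exists (A : 'M[K]_s) (B : 'M[K]_(s, k)),
    alternating A /\ M = block_mx A B (- B^T) 0)).
Proof.
case: n / e in S A0 V X * => hS altS free_X XV kill.
have [P uP h] := congruent_WA hS altS free_X XV kill.
exists P => // A; rewrite h; split=> -[B WB ->].
  by exists B => //; exists B; rewrite ?castmx_id.
by case: WB => B' WB' ->; exists B'; rewrite ?castmx_id.
Qed.

End Classify.

(** * The spaces congruent to all alternating matrices of a smaller size *)

Section Span.
Variable K : fieldType.

Notation e_ i := (delta_mx 0 i : 'rV[K]_ _).

Lemma sub_lfunE (aT rT : vectType K) (f g : 'Hom(aT, rT)) x :
  (f - g)%VF x = f x - g x.
Proof. by rewrite add_lfunE opp_lfunE. Qed.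

Lemma alternating_ind m p q (f : 'Hom('M[K]_m, 'M[K]_(p, q))) :
  (forall i j, i != j -> f (wedge (e_ i) (e_ j)) = 0) ->
  forall A, alternating A -> f A = 0.
Proof.
move=> f0 A /alternatingP[B ->].
rewrite -[X in X - _]mul1mx -[X in _ - X]mulmx1 -{1}trmx1 sum_wedge linear_sum big1 // => i _.
rewrite row1 [row i B]row_sum_delta !linear_sum big1 // => j _.
rewrite linearZ /= linearZ /=; have [->|ij] := eqVneq i j; last by rewrite f0 ?scaler0.
by rewrite wedgexx linear0 scaler0.
Qed.

Lemma perm_pair (T : finType) (a b i j : T) :
  a != b -> i != j -> exists s : {perm T}, s a = i /\ s b = j.
Proof.
move=> ab ij; exists (tperm a i * tperm (tperm a i b) j)%g; rewrite !permM tpermL tpermL.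
have bi : tperm a i b != i.
  by apply: contraNneq ab => bi; apply/eqP/(@perm_inj _ (tperm a i)); rewrite tpermL bi.
by split=> //; rewrite tpermD // eq_sym.
Qed.

Lemma alternating_symp t : alternating (symp K t).
Proof.
apply/alternatingP; exists (block_mx 0 1%:M 0 0).
by rewrite tr_block_mx trmx1 !trmx0 opp_block_mx add_block_mx !oppr0 !addr0 add0r.
Qed.

(** The nondegenerate alternating matrices affinely span all alternating ones.
    For [1 < s], the standard symplectic matrix [J] stays invertible when the
    wedge of its first two basis vectors is added, and a permutation of the
    coordinates moves this wedge to any other one. For [s = 1] there must be
    two distinct nonzero multiples of [J], which fails over the field with two
    elements. *)
Lemma nondegenerate_span s p q (k : 'M[K]_(p, q)) (f : 'Hom('M[K]_(s + s), 'M[K]_(p, q))) :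
  (1 < s)%N \/ s = 1%N /\ (exists c : K, c != 0 /\ c != 1) ->
  (forall B, alternating B -> B \in unitmx -> k + f B = 0) ->
  k = 0 /\ forall B, alternating B -> f B = 0.
Proof.
move=> hs vanish.
have uJ : symp K s \in unitmx by rewrite -row_free_unit symp_free.
have kJ := vanish _ (alternating_symp s) uJ.
suff f0 : forall B, alternating B -> f B = 0.
  by split=> //; rewrite f0 ?addr0 in kJ => //; apply: alternating_symp.
apply: alternating_ind => i j ij.
case: hs => [s2|[s1 [c [c0 c1]]]]; last first.
  have fJ : f (symp K s) = 0.
    have := vanish (c *: symp K s); rewrite unitmxZ ?unitfE // => /(_ _ uJ).
    rewrite linearZ /= => h; have {}h := h (alternatingZ c (alternating_symp s)).
    have : (c - 1) *: f (symp K s) = 0.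
      by rewrite scalerBl scale1r -(addKr k (c *: _)) h addr0 -opprD kJ oppr0.
    by move/eqP; rewrite scaler_eq0 subr_eq0 (negPf c1) => /eqP.
  suff : exists a, wedge (e_ i) (e_ j) = a *: symp K s.
    by case=> a ->; rewrite linearZ /= fJ scaler0.
  move: s1 i j ij {vanish fJ kJ uJ} f => -> i j ij _.
  pose x0 : 'I_(1 + 1) := lshift 1 0; pose x1 : 'I_(1 + 1) := rshift 1 0.
  exists (wedge (e_ i) (e_ j) x0 x1); apply/matrixP=> x y.
  have alt := alternating_wedge (e_ i) (e_ j).
  have alt2 := alternating_symp 1.
  have s01 : symp K 1 x0 x1 = 1 by rewrite block_mxEur mxE eqxx.
  have cases (z : 'I_(1 + 1)) : z = x0 \/ z = x1.
    by case: (split_ordP z) => z' ->; rewrite ord1; [left | right].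
  rewrite [RHS]mxE; case: (cases x) (cases y) => -> [] ->; rewrite ?s01 ?mulr1 //.
  - by rewrite (proj2 alt) (proj2 alt2) mulr0.
  - by rewrite (alternating_entry x0 x1 alt) (alternating_entry x0 x1 alt2) s01 mulrN mulr1.
  - by rewrite (proj2 alt) (proj2 alt2) mulr0.
pose a' : 'I_s := Ordinal (ltnW s2); pose b' : 'I_s := Ordinal s2.
pose a := lshift s a'; pose b := lshift s b'.
have ab : a != b by [].
have [t [ta tb]] := perm_pair ab ij; pose P : 'M[K]_(s + s) := perm_mx t.
have eP k' : e_ k' *m P = e_ (t k') by rewrite -rowE; apply/rowP=> l; rewrite !mxE eq_sym.
have uP : P \in unitmx by apply: unitmx_perm.
pose E := wedge (e_ a' : 'rV_s) (e_ b').
have eab : wedge (e_ a) (e_ b) = block_mx E 0 0 0.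
  have el (x : 'I_s) : e_ (lshift s x) = row_mx (e_ x) (0 : 'rV_s).
    apply/rowP=> y; case: (split_ordP y) => z ->.
      by rewrite row_mxEl !mxE eq_lshift.
    by rewrite row_mxEr !mxE eq_rlshift.
  rewrite !el /wedge !tr_row_mx !mul_col_row !trmx0 !mulmx0 !mul0mx.
  by rewrite opp_block_mx add_block_mx !subr0.
have uE : symp K s + wedge (e_ a) (e_ b) \in unitmx.
  rewrite eab add_block_mx add0r !addr0 -row_free_unit.
  apply/row_freeP; exists (block_mx 0 (- 1%:M) 1%:M E); rewrite mulmx_block.
  rewrite !mulmx0 !mul0mx !mulmxN !mulNmx !mulmx1 !mul1mx opprK !addr0 add0r addNr.
  by rewrite -scalar_mx_block.
have altJ := alternating_symp s.
have v1 := vanish (P^T *m symp K s *m P) (alternating_conj P altJ).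
have v2 := vanish (P^T *m (symp K s + wedge (e_ a) (e_ b)) *m P)
   (alternating_conj P (alternatingD altJ (alternating_wedge _ _))).
rewrite !unitmx_mul unitmx_tr uP uJ /= in v1; rewrite !unitmx_mul unitmx_tr uP uE /= in v2.
have {}v1 := v1 isT; have {}v2 := v2 isT.
rewrite mulmxDr mulmxDl linearD /= addrA v1 add0r wedge_conj !eP ta tb in v2.
exact: v2.
Qed.

(** [A |-> restr Q^T A] identifies the alternating matrices of size [s + s] with
    those of size [m] killed by [u]. *)
Lemma corank1_span s m p q (em : m = (s + s).+1) (u : 'rV[K]_m) (k : 'M[K]_(p, q))
    (f : 'Hom('M[K]_m, 'M[K]_(p, q))) :
  (1 < s)%N \/ s = 1%N /\ (exists c : K, c != 0 /\ c != 1) -> u != 0 ->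
  (forall A, alternating A -> u *m A = 0 -> \rank A = s.*2 -> k + f A = 0) ->
  k = 0 /\ forall A, alternating A -> u *m A = 0 -> f A = 0.
Proof.
subst m => hs u0 vanish.
have [|Y [Q [R [_ uQ RQ _ YQ]]]] := @quotient_maps K 1 (s + s) u.
  by rewrite row_free_rV.
have rQ : \rank Q^T = (s + s)%N.
  by apply/eqP/row_freeP; exists R^T; rewrite -trmx_mul RQ trmx1.
have [|k0 f0] := @nondegenerate_span s p q k (f \o restr Q^T)%VF hs.
  move=> B altB uB; rewrite comp_lfunE /= restrE; apply: vanish.
  - exact: alternating_conj.
  - by rewrite trmxK !mulmxA uQ !mul0mx.
  rewrite mxrankMfree; last by rewrite /row_free rQ.
  by rewrite mxrankMfree ?row_free_unit // trmxK -mxrank_tr rQ addnn.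
split=> // A altA uA.
have Au : A *m u^T = 0.
  by apply: trmx_inj; rewrite trmx_mul trmxK (proj1 altA) mulmxN uA oppr0 trmx0.
have AE : A = A *m R^T *m Q^T.
  rewrite -[LHS]mulmx1 -trmx1 -YQ linearD /= !trmx_mul mulmxDr !mulmxA Au.
  by rewrite mul0mx add0r.
have AE2 : A = restr Q^T (R *m A *m R^T).
  rewrite restrE trmxK !mulmxA.
  have : A^T = (A *m R^T *m Q^T)^T by rewrite -AE.
  rewrite !trmx_mul !trmxK (proj1 altA) !mulmxN mulmxA => /oppr_inj e.
  by rewrite -e -AE.
rewrite AE2 -comp_lfunE f0 // -{1}[R]trmxK; exact: alternating_conj.
Qed.

Lemma mul_wedge_delta m (u : 'rV[K]_m) i j :
  u *m wedge (e_ i) (e_ j) = u 0 i *: e_ j - u 0 j *: e_ i.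
Proof.
rewrite mulmxBr !mulmxA !trmx_delta -!colE.
by rewrite [col i u]mx11_scalar [col j u]mx11_scalar !mul_scalar_mx !mxE.
Qed.

(** The hypothesis makes row [i] of [h (wedge e_i e_j)] depend only on [j],
    as one sees with [u = e_k + e_i] and [A = wedge (e_k - e_i) e_j]; it is
    the row [j] of [Z]. *)
Lemma wedge_factor m n (h : 'Hom('M[K]_m, 'M[K]_(m, n))) : (1 < m)%N ->
  (forall (u : 'rV_m) A, alternating A -> u *m A = 0 -> u *m h A = 0) ->
  exists Z : 'M[K]_(m, n), forall A, alternating A -> h A = A *m Z.
Proof.
move=> m1 hu; pose E i j := wedge (e_ i : 'rV_m) (e_ j).
pose P i j := e_ i *m h (E i j).
have mulE u i j : u *m E i j = u 0 i *: e_ j - u 0 j *: e_ i by apply: mul_wedge_delta.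
have altE i j : alternating (E i j) by apply: alternating_wedge.
have other l i j : l != i -> l != j -> e_ l *m h (E i j) = 0.
  move=> li lj; apply: hu => //; rewrite mulE !mxE !eqxx /=.
  by rewrite ![_ == l]eq_sym (negPf li) (negPf lj) !scale0r subrr.
have indep i k j : i != j -> k != j -> P i j = P k j.
  move=> ij kj; have [->//|ik] := eqVneq i k.
  have : (e_ k + e_ i) *m h (E k j - E i j) = 0.
    apply: hu; first exact: alternatingB.
    rewrite mulmxBr !mulE !mxE !eqxx /= (negPf ik) [k == i]eq_sym (negPf ik).
    rewrite ![j == _]eq_sym (negPf ij) (negPf kj) !addr0 !add0r !scale0r !subr0.
    by rewrite subrr.
  have ki : k != i by rewrite eq_sym.
  rewrite linearB /= mulmxBr !mulmxDl (other k i j) // (other i k j) //.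
  by rewrite addr0 add0r => /eqP; rewrite subr_eq0 => /eqP.
pose i0 : 'I_m := Ordinal (ltnW m1); pose i1 : 'I_m := Ordinal m1.
pose g j := if j == i0 then i1 else i0.
have gj j : g j != j.
  by rewrite /g; have [->|] := eqVneq j i0; rewrite // eq_sym.
pose Z := \matrix_j P (g j) j.
have rowZ i j : i != j -> e_ j *m Z = P i j.
  by move=> ij; rewrite -rowE rowK; apply: indep.
exists Z => A altA; apply/eqP; rewrite -subr_eq0; apply/eqP.
have -> : h A - A *m Z = (h - linfun (mulmxr Z))%VF A.
  by rewrite sub_lfunE /= lfunE.
apply: alternating_ind altA => i j ij; rewrite sub_lfunE /= lfunE /=.
rewrite -/(E i j); apply/row_matrixP => l; rewrite row0 rowE mulmxBr mulmxA mulE.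
rewrite !mxE eqxx /=.
have [->|li] := eqVneq l i.
  rewrite ?[i == j](negPf ij) ?[j == i]eq_sym ?(negPf ij) ?eqxx ?scale1r ?scale0r subr0 (rowZ i) //.
  by rewrite /P subrr.
have [->|lj] := eqVneq l j.
  rewrite ?eqxx ?(negPf ij) ?[j == i]eq_sym ?(negPf ij) scale0r scale1r sub0r mulNmx (rowZ j) 1?eq_sym // opprK.
  have -> : E i j = - E j i by rewrite /E wedgeC.
  by rewrite linearN /= mulmxN /P addNr.
by rewrite other // ?[j == l]eq_sym ?(negPf lj) !scale0r subrr mul0mx subrr.
Qed.

(** By dimension, [restr Q] maps [V] isomorphically onto the alternating
    matrices of size [m]. *)
Lemma restr_section n m (Q : 'M[K]_(n, m)) (V : {vspace 'M[K]_n}) :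
  (V <= altv K n)%VS -> (forall N, N \in V -> restr Q N = 0 -> N = 0) ->
  \dim V = 'C(m, 2) ->
  exists g : 'Hom('M[K]_m, 'M[K]_n),
    (forall A, alternating A -> g A \in V /\ restr Q (g A) = A) /\
    (forall N, N \in V -> g (restr Q N) = N).
Proof.
move=> altV inj dV.
have dW : \dim (restr Q @: V) = \dim V.
  apply: limg_dim_eq; apply/eqP; rewrite -subv0; apply/subvP => N.
  by rewrite memv_cap memv_ker memv0 => /andP[NV /eqP /(inj _ NV) ->].
have img : (restr Q @: V = altv K m)%VS.
  by apply/eqP; rewrite eqEdim restr_alt // dW dV dim_alt.
pose f := (restr Q \o projv V)%VF.
have imf : (limg f = altv K m)%VS by rewrite limg_comp limg_proj img.
pose g := (projv V \o f^-1)%VF.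
have gV A : g A \in V by rewrite comp_lfunE memv_proj.
have fg A : alternating A -> restr Q (g A) = A.
  move=> /memv_alt altA; have AE : f (f^-1%VF A) = A by rewrite limg_lfunVK ?imf.
  by rewrite -[RHS]AE [in RHS]comp_lfunE [in LHS]comp_lfunE.
exists g; split=> [A altA|N NV]; first by rewrite fg.
apply/eqP; rewrite -subr_eq0; apply/eqP; apply: inj; first by rewrite memvB.
rewrite linearB /= fg ?subrr //; apply/memv_alt.
by rewrite -img memv_img.
Qed.

(** The affine space is [{C + g A}] where [A] ranges over the alternating
    matrices of size [2 * s + 1] and [restr Q (C + g A) = A]. When [A] has rank
    [2 * s], so has [C + g A], and [conj_rank_factor] shows that [u *m A = 0]
    implies [u *m Q^T *m (C + g A) = 0]. By [corank1_span], this extends to all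
    [A], so that [Q^T *m C = 0], and [wedge_factor] yields [Z] with
    [Q^T *m g A = A *m Z]. Then [C + g A = Z^T *m A *m Z] for [A] of rank
    [2 * s], hence for all [A] again by [corank1_span], as [A] is singular. *)
Lemma full_restriction n s m (em : m = (s + s).+1) (Q : 'M[K]_(n, m)) A0 V :
  (1 < s)%N \/ s = 1%N /\ (exists c : K, c != 0 /\ c != 1) ->
  bounded A0 V s -> (forall N, N \in V -> restr Q N = 0 -> N = 0) ->
  \dim V = 'C(m, 2) ->
  exists Z : 'M[K]_(m, n), Z *m Q = 1%:M /\
    forall A, A - A0 \in V <-> exists2 B, alternating B & A = Z^T *m B *m Z.
Proof.
move=> hs bS inj dV; have [altA0 altV rS] := bS.
have m2 : (2 < m)%N by rewrite em; case: hs => [|[]]; lia.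
have [g [gP gK]] := restr_section altV inj dV.
have altQ A : alternating A -> alternating (restr Q A).
  by move=> altA; rewrite restrE; apply: alternating_conj.
pose C := A0 - g (restr Q A0).
have gA0 : g (restr Q A0) \in V by case: (gP _ (altQ _ altA0)).
have altC : alternating C.
  by apply: alternatingB => //; apply/memv_alt/(subvP altV).
have QC : restr Q C = 0.
  by rewrite linearB /= (proj2 (gP _ (altQ _ altA0))) subrr.
have QM A : alternating A -> restr Q (C + g A) = A.
  by move=> altA; rewrite restrD QC add0r; case: (gP _ altA).
have altM A : alternating A -> alternating (C + g A).
  move=> altA; apply: alternatingD => //; apply/memv_alt/(subvP altV).
  by case: (gP _ altA).
have rM A : alternating A -> (\rank (C + g A)%R <= s.*2)%N.
  move=> altA; rewrite /C -addrA; apply: rS; rewrite addrC memvB //.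
  by case: (gP _ altA).
have core A : alternating A -> \rank A = s.*2 -> exists Y : 'M_(m, n),
  [/\ C + g A = Y^T *m A *m Y, Q^T *m (C + g A) = A *m Y & (C + g A) *m Q = Y^T *m A].
  move=> altA rA; have [|Y] := @conj_rank_factor _ _ _ Q _ (proj1 (altM _ altA)).
    by rewrite -restrE QM // rA rM.
  by rewrite -(restrE Q) QM // => hY; exists Y.
have step1 (u : 'rV_m) : u != 0 -> u *m Q^T *m C = 0 /\
    forall A, alternating A -> u *m A = 0 -> u *m Q^T *m g A = 0.
  move=> u0; have [|-> h0] := corank1_span em (k := u *m Q^T *m C)
      (f := (linfun (mulmx (u *m Q^T)) \o g)%VF) hs u0.
    move=> A altA uA rA; rewrite comp_lfunE lfunE /= -mulmxDr -mulmxA.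
    by have [Y [_ -> _]] := core _ altA rA; rewrite mulmxA uA mul0mx.
  by split=> // A altA uA; have := h0 A altA uA; rewrite comp_lfunE lfunE.
have QC0 : Q^T *m C = 0.
  apply/row_matrixP => i; rewrite row0 rowE mulmxA.
  by apply: (proj1 (step1 _ _)); apply/rV0Pn; exists i; rewrite mxE !eqxx oner_eq0.
pose h := (linfun (mulmx Q^T) \o g)%VF.
have hE A : h A = Q^T *m g A by rewrite comp_lfunE lfunE.
have [|u A altA uA|Z hZ] := @wedge_factor m n h; first exact: ltnW.
  have [->|u0] := eqVneq u 0; first by rewrite mul0mx.
  by rewrite hE mulmxA (proj2 (step1 u u0)).
have MZ A : alternating A -> \rank A = s.*2 -> C + g A = Z^T *m A *m Z.
  move=> altA rA; have [Y [MY QY YQ]] := core _ altA rA.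
  have AY : A *m Y = A *m Z by rewrite -QY mulmxDr QC0 add0r -hE hZ.
  have YA : Y^T *m A = Z^T *m A.
    apply: oppr_inj; rewrite -!mulmxN -(proj1 altA) -!trmx_mul.
    by rewrite AY.
  by rewrite MY -mulmxA AY mulmxA YA.
have step2 (u : 'rV_m) : u != 0 -> C = 0 /\
    forall A, alternating A -> u *m A = 0 -> (g - restr Z)%VF A = 0.
  move=> u0; apply: (corank1_span em (f := (g - restr Z)%VF) hs u0) => A altA uA rA.
  by rewrite sub_lfunE /= restrE addrA MZ // subrr.
have gZ A : alternating A -> g A = Z^T *m A *m Z.
  move=> altA; have [u u0 uA] : exists2 u : 'rV_m, u != 0 & u *m A = 0.
    have : kermx A != 0.
      rewrite kermx_eq0 /row_free; apply/eqP => rA.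
      by have := rank_alternating_even altA; rewrite rA em /= addnn odd_double.
    case/matrix0Pn=> i [j nz]; exists (row i (kermx A)).
      by apply/rV0Pn; exists j; rewrite mxE.
    by rewrite -row_mul mulmx_ker row0.
  have := (proj2 (step2 u u0)) A altA uA.
  by rewrite sub_lfunE /= restrE => /eqP; rewrite subr_eq0 => /eqP.
have C0 : C = 0.
  have e0 : delta_mx 0 (Ordinal m2) != 0 :> 'rV[K]_m.
    by apply/rV0Pn; exists (Ordinal m2); rewrite mxE !eqxx oner_eq0.
  exact: (proj1 (step2 _ e0)).
have ZQ : Z *m Q = 1%:M.
  apply/eqP; rewrite -subr_eq0; apply/eqP/row_matrixP => j.
  have [i ij] : exists i : 'I_m, i != j.
    have [ej|] := eqVneq j (Ordinal m2); last by exists (Ordinal m2); rewrite eq_sym.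
    by exists (Ordinal (ltnW m2)); rewrite ej.
  have altE := alternating_wedge (e_ i : 'rV_m) (e_ j).
  have : wedge (e_ i : 'rV_m) (e_ j) *m (Z *m Q - 1%:M) = 0.
    by rewrite mulmxBr mulmx1 mulmxA -hZ // hE -restrE (proj2 (gP _ altE)) subrr.
  move/(congr1 (mulmx (e_ i))); rewrite mulmx0 mulmxA mul_wedge_delta !mxE !eqxx.
  by rewrite [j == i]eq_sym (negPf ij) scale1r scale0r subr0 -rowE row0.
have A0V : A0 \in V.
  by move/eqP: C0; rewrite subr_eq0 => /eqP ->.
exists Z; split=> // A; split=> [AV|[B altB ->]]; last first.
  by rewrite -gZ // memvB //; case: (gP _ altB).
have {}AV : A \in V by rewrite -(subrK A0 A) memvD.
have altA : alternating A by apply/memv_alt/(subvP altV).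
exists (restr Q A); first exact: altQ.
by rewrite -gZ ?gK //; apply: altQ.
Qed.

End Span.

(** * Rank 2 in dimension 4 over the field with two elements *)

Section Small.
Variable K : fieldType.
Notation e_ i := (delta_mx 0 i : 'rV[K]_ _).

Let i0 : 'I_3 := @Ordinal 3 0 isT.
Let i1 : 'I_3 := @Ordinal 3 1 isT.
Let i2 : 'I_3 := @Ordinal 3 2 isT.

Lemma ord3P (P : 'I_3 -> Prop) : P i0 -> P i1 -> P i2 -> forall i, P i.
Proof.
move=> p0 p1 p2 [[|[|[|//]]] p].
- by rewrite (_ : Ordinal p = i0) //; apply: val_inj.
- by rewrite (_ : Ordinal p = i1) //; apply: val_inj.
- by rewrite (_ : Ordinal p = i2) //; apply: val_inj.
Qed.

Definition alt3 (a b c : K) : 'M[K]_3 :=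
  a *: wedge (e_ i0) (e_ i1) + b *: wedge (e_ i0) (e_ i2) + c *: wedge (e_ i1) (e_ i2).

Lemma alternating_alt3 a b c : alternating (alt3 a b c).
Proof.
by do ![exact: alternating_wedge | apply: alternatingZ | apply: alternatingD].
Qed.

Lemma alt3E a b c :
  [/\ alt3 a b c i0 i1 = a, alt3 a b c i0 i2 = b & alt3 a b c i1 i2 = c].
Proof. by split; rewrite /alt3 !mxE !big_ord1 !mxE /=; ring. Qed.

Lemma alternating3 A : alternating A -> A = alt3 (A i0 i1) (A i0 i2) (A i1 i2).
Proof.
move=> altA; have [e1 e2 e3] := alt3E (A i0 i1) (A i0 i2) (A i1 i2).
have altB := alternating_alt3 (A i0 i1) (A i0 i2) (A i1 i2).
move: (alt3 _ _ _) e1 e2 e3 altB => B e1 e2 e3 altB.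
apply/matrixP; apply: ord3P; apply: ord3P;
  rewrite ?(proj2 altA) ?(proj2 altB) ?e1 ?e2 ?e3 //.
- by rewrite (alternating_entry i0 i1 altA) (alternating_entry i0 i1 altB) e1.
- by rewrite (alternating_entry i0 i2 altA) (alternating_entry i0 i2 altB) e2.
- by rewrite (alternating_entry i1 i2 altA) (alternating_entry i1 i2 altB) e3.
Qed.

Lemma alt3_ker a b c :
  (c *: e_ i0 - b *: e_ i1 + a *: e_ i2) *m alt3 a b c = 0.
Proof.
rewrite /alt3 !mulmxDr -!scalemxAr !mul_wedge_delta.
by apply/rowP; apply: ord3P; rewrite !mxE /=; ring.
Qed.

(** The affine map [A |-> k *: e + f A] sends each nonzero [A] into the image of
    [A]. Testing the seven nonzero matrices with entries 0 and 1 above the diagonal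
    determines its linear part up to a term [A *m w]; over the field with two
    elements these are all the nonzero alternating matrices. *)
Lemma affine_dual (k : K) (f : 'Hom('M[K]_3, 'cV[K]_3)) :
  (forall (u : 'rV_3) A, alternating A -> A != 0 -> u *m A = 0 ->
     u *m (k *: delta_mx i0 0 + f A) = 0) ->
  exists w, forall A, alternating A ->
    k *: delta_mx i0 0 + f A = A *m w + (k * (1 - A i1 i2)) *: delta_mx i0 0.
Proof.
move=> hf.
pose fa := f (wedge (e_ i0) (e_ i1)); pose fb := f (wedge (e_ i0) (e_ i2)).
pose fc := f (wedge (e_ i1) (e_ i2)).
have fE a b c : f (alt3 a b c) = a *: fa + b *: fb + c *: fc.
  have fD (x y : 'M_3) : f (x + y) = f x + f y by apply: linearD.
  have fZ e (x : 'M_3) : f (e *: x) = e *: f x by apply: linearZ.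
  by rewrite /alt3 !fD !fZ.
have test a b c : [|| a != 0, b != 0 | c != 0] ->
    c * (k + a * fa i0 0 + b * fb i0 0 + c * fc i0 0)
    - b * (a * fa i1 0 + b * fb i1 0 + c * fc i1 0)
    + a * (a * fa i2 0 + b * fb i2 0 + c * fc i2 0) = 0.
  move=> nz; have := hf _ _ (alternating_alt3 a b c) _ (alt3_ker a b c).
  have -> : alt3 a b c != 0.
    have [e1 e2 e3] := alt3E a b c; apply: contraTneq nz => z.
    by move: e1 e2 e3; rewrite z !mxE => <- <- <-; rewrite eqxx.
  move/(_ isT)/matrixP/(_ 0 0); rewrite fE !mulmxDl mulNmx -!scalemxAl -!rowE !mxE /=.
  by move=> <-; ring.
have n0 : (0 : K) != 0 = false by rewrite eqxx.
have n1 : (1 : K) != 0 by apply: oner_neq0.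
have ta : fa i2 0 = 0 by have := test 1 0 0; rewrite n1 /= => <-; rewrite ?orbT //; ring.
have tb : fb i1 0 = 0.
  by apply: oppr_inj; rewrite oppr0; have := test 0 1 0; rewrite n1 orbT /= => <-; rewrite ?orbT //; ring.
have tc : fc i0 0 = - k.
  by apply: (addrI k); rewrite subrr; have := test 0 0 1; rewrite n1 !orbT /= => <-; rewrite ?orbT //; ring.
have tab : fb i2 0 = fa i1 0.
  apply: subr0_eq; have := test 1 1 0; rewrite n1 /= ta tb => <-; rewrite ?orbT //; ring.
have tac : fc i2 0 = - fa i0 0.
  apply: subr0_eq; have := test 1 0 1; rewrite n1 /= ta tc => <-; rewrite ?orbT //; ring.
have tbc : fc i1 0 = fb i0 0.
  by apply/esym/subr0_eq; have := test 0 1 1; rewrite n1 orbT /= tb tc => <-; rewrite ?orbT //; ring.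
(* Read off from the coefficients of A *m w, as A has entries (0, a, b), (-a, 0, c), (-b, -c, 0). *)
exists (- fa i1 0 *: delta_mx i0 0 + fa i0 0 *: delta_mx i1 0 + fb i0 0 *: delta_mx i2 0).
move=> A altA; rewrite [f A](_ : _ = f (alt3 (A i0 i1) (A i0 i2) (A i1 i2))); last first.
  by rewrite -alternating3.
rewrite fE !mulmxDr -!scalemxAr -!colE.
have a10 := alternating_entry i0 i1 altA; have a20 := alternating_entry i0 i2 altA.
have a21 := alternating_entry i1 i2 altA; have aii := proj2 altA.
apply/colP; apply: ord3P; rewrite !mxE /= ?aii ?a10 ?a20 ?a21.
- by rewrite tc; ring.
- by rewrite tb tbc; ring.
- by rewrite ta tab tac; ring.
Qed.


Lemma wedge_mxE n (R : 'M[K]_(3, n)) (z : 'rV_n) :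
  wedge (row i0 R) z = R^T *m delta_mx i0 0 *m z - z^T *m delta_mx 0 i0 *m R.
Proof. by rewrite /wedge rowE trmx_mul trmx_delta !mulmxA. Qed.

(** In the basis given by the rows of [R] and [z], a matrix of the affine space
    is determined by its upper left block [A] and by a column that is an affine
    function of [A]; [affine_dual] gives the latter, and its term [A *m w] is
    absorbed by replacing [R] with [R + w *m z]. *)
Lemma graph_normal_form n (Q : 'M[K]_(n, 3)) R z Y C k (V : {vspace 'M[K]_n}) :
  R *m Q = 1%:M -> z *m Q = 0 -> z *m Y = 1%:M -> Q *m R + Y *m z = 1%:M ->
  C = k *: wedge (row i0 R) z ->
  bounded C V 1 -> (forall N, N \in V -> restr Q N = 0 -> N = 0) -> \dim V = 3%N ->
  exists w : 'cV_3, forall A, A - C \in V <-> exists2 B, alternating B &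
    A = (R + w *m z)^T *m B *m (R + w *m z)
        + (k * (1 - B i1 i2)) *: wedge (row i0 (R + w *m z)) z.
Proof.
move=> RQ zQ zY QR CE bS inj dV; have [altC altV rS] := bS.
have [g [gP gK]] := restr_section altV inj dV.
have QC : restr Q C = 0.
  by rewrite CE restrZ restr_wedge zQ linear0 scaler0.
have altM A : alternating A -> alternating (C + g A).
  by move=> altA; apply: (bounded_alt bS); case: (gP _ altA).
have QM A : alternating A -> Q^T *m (C + g A) *m Q = A.
  by move=> altA; rewrite -restrE restrD QC add0r; case: (gP _ altA).
pose f := (linfun (mulmxr Y \o mulmx Q^T) \o g)%VF.
have fE A : Q^T *m (C + g A) *m Y = k *: delta_mx i0 0 + f A.
  rewrite mulmxDr mulmxDl comp_lfunE lfunE /=; congr (_ + _).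
  rewrite CE -scalemxAr -scalemxAl; congr (_ *: _).
  rewrite /wedge mulmxBr mulmxBl !mulmxA -!trmx_mul zQ trmx0 !mul0mx subr0.
  by rewrite -mulmxA zY mulmx1 -row_mul RQ row1 trmx_delta.
have [w hw] : exists w, forall A, alternating A ->
    k *: delta_mx i0 0 + f A = A *m w + (k * (1 - A i1 i2)) *: delta_mx i0 0.
  apply: affine_dual => u A altA A0 uA; rewrite -fE.
  have rA : \rank A = 2%N.
    have := rank_alternating_even altA; have := rank_leq_row A.
    have : (0 < \rank A)%N by rewrite lt0n mxrank_eq0.
    by case: (\rank A) => [|[|[|[]]]].
  have [|Y' [_ QY _]] := @conj_rank_factor _ _ _ Q _ (proj1 (altM _ altA)).
    by rewrite QM // rA; apply: rS; case: (gP _ altA).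
  by rewrite mulmxA QY QM // !mulmxA uA !mul0mx.
pose Z := R + w *m z.
have decomp A : alternating A ->
    C + g A = Z^T *m A *m Z + (k * (1 - A i1 i2)) *: wedge (row i0 Z) z.
  move=> altA; set M := C + g A; set k' := k * _.
  have Mt : M^T = - M := proj1 (altM _ altA).
  have e1 : Q^T *m M *m Y = A *m w + k' *: delta_mx i0 0 by rewrite fE hw.
  have e2 : Y^T *m M *m Q = w^T *m A - k' *: delta_mx 0 i0.
    apply: trmx_inj; rewrite !trmx_mul trmxK Mt mulNmx mulmxN mulmxA e1.
    by rewrite linearB /= trmx_mul trmxK linearZ /= trmx_delta (proj1 altA) mulNmx opprD.
  have e3 : Y^T *m M *m Y = 0.
    by rewrite [LHS]mx11_scalar (proj2 (alternating_conj Y (altM _ altA))) raddf0.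
  have e0 : Q^T *m M *m Q = A := QM _ altA.
  clearbody M.
  have e4 : w^T *m A *m w = 0.
    by rewrite [LHS]mx11_scalar (proj2 (alternating_conj w altA)) raddf0.
  have -> : wedge (row i0 Z) z = wedge (row i0 R) z.
    rewrite /Z linearD /= row_mul [row i0 w]mx11_scalar mul_scalar_mx.
    by rewrite wedgeC wedgeDr wedgeZr wedgexx scaler0 addr0 -wedgeC.
  have tQR : (Q *m R + Y *m z)^T = R^T *m Q^T + z^T *m Y^T.
    by rewrite linearD /= !trmx_mul.
  have -> : M = (Q *m R + Y *m z)^T *m M *m (Q *m R + Y *m z).
    by rewrite QR trmx1 mul1mx mulmx1.
  rewrite tQR !mulmxDr !mulmxDl !mulmxA.
  have assoc p q r (X1 : 'M_(_, p)) (X2 : 'M_(p, n)) (X3 : 'M_(n, q)) (X4 : 'M_(q, r)) :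
    X1 *m X2 *m M *m X3 *m X4 = X1 *m (X2 *m M *m X3) *m X4 by rewrite !mulmxA.
  rewrite !assoc e0 e1 e2 e3 mulmx0 mul0mx addr0.
  have Zt : Z^T = R^T + z^T *m w^T by rewrite linearD /= trmx_mul.
  rewrite Zt wedge_mxE scalerBr !mulmxDr !mulmxDl mulmxN mulNmx !mulmxA.
  have -> : z^T *m w^T *m A *m w *m z = 0.
    by rewrite -[z^T *m w^T *m A]mulmxA -[z^T *m _ *m w]mulmxA e4 mulmx0 mul0mx.
  rewrite -!scalemxAr -!scalemxAl addr0.
  move: (R^T *m A *m R) (z^T *m w^T *m A *m R) (R^T *m A *m w *m z).
  move: (k' *: (R^T *m _ *m z)) (k' *: (z^T *m _ *m R)) => a b c d e.
  by apply/matrixP=> x y; rewrite !mxE; ring.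
exists w => A; split=> [AV|[B altB ->]]; last first.
  by rewrite -/Z -decomp // addrC addKr; case: (gP _ altB).
exists (restr Q (A - C)).
  by rewrite restrE; apply/alternating_conj/memv_alt/(subvP altV).
rewrite -/Z -decomp; last by rewrite restrE; apply/alternating_conj/memv_alt/(subvP altV).
by rewrite gK // addrC subrK.
Qed.

(** The matrix [C] of the affine space with [restr Q C = 0] is a wedge with [z];
    the basis of [graph_normal_form] is chosen so that its first vector is the other
    factor, if [C] is nonzero. *)
Lemma normal_form_dim4 (A0 : 'M[K]_4) V (Q : 'M[K]_(4, 3)) :
  bounded A0 V 1 -> (forall N, N \in V -> restr Q N = 0 -> N = 0) -> \dim V = 3%N ->
  exists (Z : 'M[K]_(3, 4)) (z : 'rV_4) k, col_mx Z z \in unitmx /\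
    forall A, A - A0 \in V <-> exists2 B, alternating B &
      A = Z^T *m B *m Z + (k * (1 - B i1 i2)) *: wedge (row i0 Z) z.
Proof.
move=> bS inj dV; have [altA0 altV rS] := bS.
have [g [gP gK]] := restr_section altV inj dV.
have altQ A : alternating A -> alternating (restr Q A).
  by move=> altA; rewrite restrE; apply: alternating_conj.
pose C := A0 - g (restr Q A0).
have [gA0 QgA0] := gP _ (altQ _ altA0).
have QC : restr Q C = 0 by rewrite linearB /= QgA0 subrr.
have altC : alternating C.
  by apply: alternatingB => //; apply/memv_alt/(subvP altV).
have bC : bounded C V 1.
  by split=> // N NV; rewrite -addrA; apply: rS; rewrite addrC memvB.
have SC A : A - A0 \in V <-> A - C \in V.
  have -> : A - C = A - A0 + g (restr Q A0) by rewrite opprB addrA addrAC.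
  split=> h; first by rewrite memvD.
  by rewrite -(addrK (g (restr Q A0)) (A - A0)) memvB.
have free_Q : row_free Q^T.
  rewrite -kermx_eq0; apply/eqP/row_matrixP => i; rewrite row0.
  set v := row i _; have vQ : v *m Q^T = 0 by rewrite -row_mul mulmx_ker row0.
  have vA A : alternating A -> v *m A = 0.
    by move=> altA; have [_ <-] := gP _ altA; rewrite restrE !mulmxA vQ !mul0mx.
  have h (x y : 'I_3) : x != y -> v 0 x = 0.
    move=> xy; have := vA _ (alternating_wedge (e_ x) (e_ y)).
    rewrite mul_wedge_delta => /rowP/(_ y); rewrite !mxE !eqxx /=.
    by rewrite [y == x]eq_sym (negPf xy) mulr1 mulr0 subr0.
  apply/rowP; apply: ord3P; rewrite [RHS]mxE.
  - exact: (h i0 i1).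
  - exact: (h i1 i0).
  - exact: (h i2 i0).
have [Y' [Q1 [R' [QY QQ RQ1 _ YQ]]]] := @quotient_maps K 3 1 Q^T free_Q.
pose R := Y'^T; pose z := Q1^T; pose Y := R'^T.
have RQ : R *m Q = 1%:M by rewrite -[Q]trmxK -trmx_mul QY trmx1.
have zQ : z *m Q = 0 by rewrite -[Q]trmxK -trmx_mul QQ trmx0.
have zY : z *m Y = 1%:M by rewrite -trmx_mul RQ1 trmx1.
have QR : Q *m R + Y *m z = 1%:M.
  by rewrite -[Q]trmxK -!trmx_mul -linearD /= YQ trmx1.
have [p Cp] : exists p, C = wedge z p.
  apply: restr_ker QC => //; split=> //; exists Y, R; split=> //.
  by rewrite addrC.
have Cc : C = wedge z (p *m Q *m R).
  rewrite Cp -{1}[p]mulmx1 -QR mulmxDr wedgeDr !mulmxA.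
  by rewrite [p *m Y]mx11_scalar mul_scalar_mx wedgeZr wedgexx scaler0 addr0.
have main (G : 'M_3) k : G \in unitmx -> C = k *: wedge (row i0 (G *m R)) z ->
    exists (Z : 'M[K]_(3, 4)) (z : 'rV_4) k, col_mx Z z \in unitmx /\
    forall A, A - A0 \in V <-> exists2 B, alternating B &
      A = Z^T *m B *m Z + (k * (1 - B i1 i2)) *: wedge (row i0 Z) z.
  move=> uG CG.
  have [||||w hw] := @graph_normal_form 4 (Q *m invmx G) (G *m R) z Y C k V _ _ zY _ CG bC _ dV.
  - by rewrite mulmxA -[G *m R *m Q]mulmxA RQ mulmx1 mulmxV.
  - by rewrite mulmxA zQ mul0mx.
  - by rewrite mulmxA mulmxKV.
  - move=> N NV N0; apply: inj => //.
    by rewrite -[Q](mulmxKV uG) -restr_comp N0 linear0.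
  exists (G *m R + w *m z), z, k; split=> [|A]; last by rewrite SC hw.
  suff : (1%:M <= col_mx (G *m R + w *m z)%R z)%MS by rewrite sub1mx row_full_unit.
  have zU := col_mxSr (G *m R + w *m z) z.
  have RU : (R <= col_mx (G *m R + w *m z)%R z)%MS.
    rewrite -[R in (R <= _)%MS](mulKmx uG) mulmx_sub //.
    rewrite -[X in (X <= _)%MS](addrK (w *m z)).
    by rewrite addmx_sub ?col_mxSl // eqmx_opp mulmx_sub.
  by rewrite -QR addmx_sub // mulmx_sub.
have [c0|c0] := eqVneq (p *m Q) 0.
  by apply: (main 1%:M 0); rewrite ?unitmx1 // Cc c0 mul0mx linear0 scale0r.
have [G' uG] : exists G' : 'M[K]_(2, 3), col_mx (p *m Q) G' \in unitmx.
  by apply: (@completion K 1 2); rewrite row_free_rV.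
apply: (main _ (- 1) uG); rewrite Cc wedgeC scaleN1r; congr (- wedge _ _).
rewrite rowE mulmxA -rowE; congr (_ *m _).
have -> : i0 = lshift 2 (0 : 'I_1) by apply: val_inj.
by rewrite -[LHS](row_id 0) -(rowKu 0 (p *m Q) G').
Qed.

(** In the basis given by the rows of [Z] and [z], the matrix in the hypothesis
    is [Umx a b c] when [B = alt3 a b c], as signs do not matter. *)
Lemma congruent_U (S : 'M[K]_4 -> Prop) (Z : 'M[K]_(3, 4)) (z : 'rV_4) :
  1 + 1 = 0 :> K -> col_mx Z z \in unitmx ->
  (forall A, S A <-> exists2 B, alternating B &
     A = Z^T *m B *m Z + (1 - B i1 i2) *: wedge (row i0 Z) z) ->
  congruent S (@U K).
Proof.
move=> two0 uP hS.
have opp (x : K) : - x = x.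
  by apply/eqP; rewrite eq_sym -subr_eq0 opprK -[x]mul1r -mulrDl two0 mul0r.
have E (a b c : K) : (col_mx Z z)^T *m (Umx a b c : 'M_(3 + 1)) *m (col_mx Z z)^T^T =
    Z^T *m alt3 a b c *m Z + (1 - c) *: wedge (row i0 Z) z.
  pose d : 'cV[K]_3 := (1 - c) *: delta_mx i0 0.
  have -> : Umx a b c = block_mx (alt3 a b c) d (- d^T) 0 :> 'M_(3 + 1).
    apply/matrixP => i j.
    case: (split_ordP i) (split_ordP j) => i' -> [] j' ->;
      rewrite ?block_mxEul ?block_mxEur ?block_mxEdl ?block_mxEdr ?ord1 [LHS]mxE.
    - have [e1 e2 e3] := alt3E a b c; have alt := alternating_alt3 a b c.
      move: (alt3 a b c) e1 e2 e3 alt => B e1 e2 e3 alt.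
      have f1 := alternating_entry i0 i1 alt.
      have f2 := alternating_entry i0 i2 alt.
      have f3 := alternating_entry i1 i2 alt.
      move: i' j'; apply: ord3P; apply: ord3P;
        by rewrite ?(proj2 alt) ?f1 ?f2 ?f3 ?e1 ?e2 ?e3 ?opp.
    - by move: i'; apply: ord3P; rewrite !mxE /= ?mulr1 ?mulr0 // opp addrC.
    - by move: j'; apply: ord3P; rewrite !mxE /= opp ?mulr1 ?mulr0 // opp addrC.
    - by rewrite mxE.
  have dt : d^T = (1 - c) *: delta_mx 0 i0 by rewrite linearZ /= trmx_delta.
  rewrite trmxK tr_col_mx mul_row_block mulmx0 addr0 mul_row_col.
  rewrite mulmxDl mulmxN mulNmx -!addrA; congr (_ + _).
  rewrite wedge_mxE scalerBr dt /d addrC.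
  by rewrite -!scalemxAr -!scalemxAl.
exists (col_mx Z z : 'M_4)^T; first by rewrite unitmx_tr.
move=> A; rewrite hS; split=> [[B altB ->]|[_ [a [b [c ->]]] ->]].
  set a := B i0 i1.
  set b := B i0 i2.
  set c := B i1 i2.
  exists (Umx a b c); first by exists a, b, c.
  by apply: esym; rewrite [in RHS](alternating3 altB); apply: E.
have [e1 e2 e3] := alt3E a b c.
exists (alt3 a b c); first exact: alternating_alt3.
by rewrite e3; apply: E.
Qed.

End Small.

(** * The theorem *)

Section Final.
Variable K : fieldType.

Lemma congruent_tilde_cast m k n (e : (m + k = n)%N) (S : 'M[K]_n -> Prop) (Z : 'M[K]_(m, n)) :
  row_free Z -> (forall A, S A <-> exists2 B, alternating B & A = Z^T *m B *m Z) ->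
  congruent S (cast_set e (fun M : 'M[K]_(m + k) =>
    exists2 B : 'M[K]_m, alternating B & M = block_mx B 0 0 0)).
Proof.
case: n / e in S Z * => free_Z hS; have [R uP] := completion free_Z.
have E B : (col_mx Z R)^T *m block_mx B 0 0 0 *m (col_mx Z R)^T^T = Z^T *m B *m Z.
  by rewrite trmxK tr_col_mx mul_row_block !mulmx0 !addr0 mul_row_col mul0mx addr0.
exists (col_mx Z R)^T; rewrite ?unitmx_tr // => A; rewrite hS; split.
  case=> B altB ->; exists (block_mx B 0 0 0); last by rewrite E.
  by exists (block_mx B 0 0 0); rewrite ?castmx_id //; exists B.
case=> _ [_ [B altB ->] ->] ->; exists B => //.
by rewrite castmx_id E.
Qed.

Lemma bounded_of n (S : 'M[K]_n -> Prop) A0 (V : {vspace 'M[K]_n}) s :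
  (forall A, S A <-> A - A0 \in V) -> (forall A, S A -> alternating A) ->
  (forall A, S A -> (\rank A <= 2 * s)%N) -> bounded A0 V s.
Proof.
move=> hS altS rS; have SD N : N \in V -> S (A0 + N).
  by move=> NV; apply/hS; rewrite addrC addKr.
have altA0 : alternating A0 by apply: altS; apply/hS; rewrite subrr mem0v.
split=> // [|N NV]; last by rewrite -mul2n rS //; apply: SD.
apply/subvP => N NV; apply/memv_alt.
have -> : N = A0 + N - A0 by rewrite [RHS]addrC addKr.
by apply: alternatingB => //; apply/altS/SD.
Qed.

(** For [n = 2 * s + 1] the bound is the dimension of the whole space. *)
Lemma full_alternating m n (e : m = n) (S : 'M[K]_n -> Prop) A0 (V : {vspace 'M[K]_n}) s :
  (forall A, S A <-> A - A0 \in V) -> bounded A0 V s -> \dim V = 'C(m, 2) ->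
  exists Z : 'M[K]_(m, n), row_free Z /\
    forall A, S A <-> exists2 B, alternating B & A = Z^T *m B *m Z.
Proof.
case: n / e in S A0 V * => hS [altA0 altV _] dV.
have VE : V = altv K m by apply/eqP; rewrite eqEdim altV dV dim_alt.
exists 1%:M; split=> [|A]; first by rewrite row_free_unit unitmx1.
rewrite hS VE; split=> [/memv_alt altA|[B altB ->]].
  exists A; last by rewrite trmx1 mul1mx mulmx1.
  by rewrite -[A](subrK A0); apply: alternatingD.
by rewrite trmx1 mul1mx mulmx1; apply/memv_alt/alternatingB.
Qed.

End Final.

Theorem theorem1p3 (K : fieldType) (n s : nat) (hs : (2 * s < n)%N)
    (S : 'M[K]_n -> Prop) (V : {vspace 'M[K]_n})
    (hSV : affine_subspace S V)
    (hSalt : forall A : 'M[K]_n, S A -> alternating A)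
    (hSrk : forall A : 'M[K]_n, S A -> (\rank A <= 2 * s)%N) :
  (\dim V <= maxn (a1 n (2 * s)) (a2 n (2 * s)))%N /\
  (\dim V = maxn (a1 n (2 * s)) (a2 n (2 * s)) ->
   [\/ congruent S (WA hs),
       congruent S (tilde (hs : ((2 * s).+1 <= n)%N) (@alternating K (2 * s).+1))
     | [/\ s = 1%N, n = 4%N, has_card K 2
         & exists e : 4%N = n, congruent S (cast_set e (@U K))]]).
Proof.
case: hSV => A0 hS; have bS := bounded_of hS hSalt hSrk.
rewrite -/(maxdim n s); split; first exact: dim_bound bS hs.
move=> dV; have [s0|s0] := posnP s.
  have S0 A : S A <-> A = 0.
    have V0 : A0 = 0 /\ V = 0%VS.
      have z N : N \in V -> A0 + N = 0.
        by case: bS => _ _ rk /rk; rewrite s0 leqn0 mxrank_eq0 => /eqP.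
      have A00 : A0 = 0 by have := z 0 (mem0v _); rewrite addr0.
      split=> //; apply/eqP; rewrite -subv0; apply/subvP => N /z.
      by rewrite A00 add0r memv0 => ->.
    by rewrite hS (proj1 V0) (proj2 V0) subr0 memv0; split=> [/eqP|->].
  (* Both sets reduce to 0, so the empty basis of rows will do. *)
  apply: Or31; apply: (@congruent_WA_cast _ _ _ _ _ _ A0 V 0) => //.
  - by rewrite -row_leq_rank s0.
  - by move=> i; have := ltn_ord i; rewrite [X in (_ < X)%N]s0 ltn0.
  - by move=> A m Q /S0 -> _; rewrite linear0.
have [[sn [_ [T [rT TV]]]]|[dV3 [Q inj]]] := dim_extremal bS hs s0 dV.
  apply: Or31.
  pose X : 'M_(s, n) := pid_mx s *m row_base T.
  have free_X : row_free X.
    by rewrite /row_free mxrankMfree ?row_base_free // rank_pid_mx ?rT.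
  have XV i u : wedge (row i X) u \in V.
    by apply: TV; rewrite -(eq_row_base T) row_mul submxMl.
  apply: (congruent_WA_cast _ hS hSalt free_X XV) => A m Q SA XQ.
  have -> : A = A0 + (A - A0) by rewrite addrC subrK.
  by apply: (restr_joined_eq0 bS sn free_X XV XQ); apply/hS.
have em : (2 * s).+1 = (s + s).+1 by rewrite mul2n addnn.
have [cond|cond] := classic ((1 < s)%N \/ s = 1%N /\ (exists c : K, c != 0 /\ c != 1)).
  have [Z [ZQ hZ]] := full_restriction em cond bS inj dV3.
  apply: Or32; apply: congruent_tilde_cast; last by move=> A; rewrite hS; apply: hZ.
  by apply/row_freeP; exists Q.
have s1 : s = 1%N.
  by apply/eqP; rewrite eqn_leq s0 andbT leqNgt; apply/negP => s2; apply: cond; left.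
have two (x : K) : x = 0 \/ x = 1.
  apply: NNPP => nx; apply: cond; right; split=> //; exists x.
  by split; apply/eqP => e; apply: nx; [left | right].
(* The second term of the maximum is n - 1 here, while dim V = 3. *)
have n4 : n = 3 \/ n = 4.
  move: dV; rewrite dV3 /maxdim => e; have := leq_maxr (a1 n (2 * s)) (a2 n (2 * s)).
  rewrite -e; have := a2E n s; move: hs; rewrite s1 (_ : 'C((2 * 1).+1, 2) = 3%N) //.
  by move: (a2 _ _) => x; lia.
have [n3|n4'] := n4.
  have e3 : (2 * s).+1 = n by rewrite n3 s1.
  have [Z [free_Z hZ]] := full_alternating e3 hS bS dV3.
  by apply: Or32; apply: congruent_tilde_cast free_Z hZ.
subst s n; have [|Z [z [k [uP hZ]]]] := normal_form_dim4 bS inj; first by rewrite dV3.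
have two0 : 1 + 1 = 0 :> K.
  by case: (two (1 + 1)) => // /eqP; rewrite -subr_eq0 addrK oner_eq0.
have [k0|k1] := two k.
  apply: Or32; apply: (@congruent_tilde_cast _ _ _ _ _ _ Z).
    move: uP; rewrite -row_free_unit => /(@row_freeP _ (3 + 1) 4)[P ZP].
    apply/row_freeP; exists (lsubmx P).
    move: ZP; rewrite -{1}[P]hsubmxK mul_col_row scalar_mx_block.
    by case/eq_block_mx.
  move=> A; rewrite hS hZ; split=> -[B altB ->]; exists B => //.
    by rewrite k0 mul0r scale0r addr0.
  by rewrite k0 mul0r scale0r addr0.
apply: Or33; split=> //.
  exists [:: 0; 1]; split=> [|//|x].
    by rewrite /= inE eq_sym oner_eq0.
  by rewrite !inE; case: (two x) => ->; rewrite eqxx ?orbT.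
exists (erefl 4); have [|P uP' hP] := @congruent_U _ S Z z two0 uP.
  by move=> A; rewrite hS hZ k1; split=> -[B altB ->]; exists B; rewrite ?mul1r.
exists P => // A; rewrite hP; split=> -[B UB ->].
  by exists B => //; exists B; rewrite ?castmx_id.
by case: UB => B' UB' ->; exists B'; rewrite ?castmx_id.
Qed.
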